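(* There is a robust, Turing-universal computational dynamical system $(f,\mathcal E,\mathcal D,\tau,\mathsf{T}_{\mathrm{univ}})$ in which $f:D^2\to D^2$ is a smooth map of the closed $2$-disk, the slowdown function is $\tau\equiv 1$, and $\mathcal E,\mathcal D$ have optimal complexity $\Theta(n)$ (i.e. $\mathcal E$ has input time complexity $\Theta(n)$ and $\mathcal D$ has output time complexity $\Theta(n)$).
   Context: A BSS$_{\mathsf C}$ machine is a Blum–Shub–Smale machine over $\mathbb R$ (a Turing-type machine with real-valued tape cells whose transition function is a semialgebraic function) all of whose finitely many machine constants are computable real numbers; a hybrid BSS$_{\mathsf C}$ machine has two tapes, one with entries in $\mathbb R$ and one with entries in a finite set $\mathbb Z_d$. Let $\mathsf T:S\to S$ be a Turing machine with configuration set $S$ (finite strings encoding tape contents, head position and internal state; $|s|$ is the length), and let $f:M\to M$ with $M\subseteq\mathbb R^k$. A tuple $(f,\mathcal E,\mathcal D,\tau,\mathsf T)$ is a computational dynamical system (CDS) with complexity $O(t(n))$ if: $\mathcal E:S\to M$ is computed by a hybrid BSS$_{\mathsf C}$ machine in time $O(t(|s|))$ (input time complexity); $\mathcal D:M\rightharpoonup S$ is a partial function computed by a hybrid BSS$_{\mathsf C}$ machine in time $O(t(|\mathcal D(x)|))$ (output time complexity); $\tau:M\rightharpoonup\mathbb Z_{\ge0}$ is defined exactly on the domain of $\mathcal D$, is constant on connected components of each $\mathcal D^{-1}(s)$, and is computed by a hybrid BSS$_{\mathsf C}$ machine in time $O(u(|\mathcal D(x)|))$ for some computable $u$; and, writing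 $C_s=\mathcal D^{-1}(s)$ and $f^\tau(x)=f^{\tau(x)}(x)$, one has $\mathcal E(s)\in C_s$ and $\mathcal D(f^\tau(C_s))=\{\mathsf T(s)\}$ for all $s\in S$. The CDS is robust if every $C_s$ is the closure of its interior and $\mathcal E(s)$ lies in the interior of $C_s$. It is Turing-universal if $\mathsf T$ is a universal Turing machine. *)

(* Defs.v *)
From Stdlib Require Import Reals ZArith.
From mathcomp Require Import ssreflect ssrfun ssrbool eqtype ssrnat seq choice fintype.

Set Implicit Arguments.
Unset Strict Implicit.
Unset Printing Implicit Defensive.

Inductive move := MoveL | MoveS | MoveR.

(** Alphabet: 'I_(tm_nsym.+3), symbol 0 is the blank (so there are at least
    two non-blank symbols 1 and 2).  States: 'I_(tm_nst.+1). *)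
Record TM := {
  tm_nsym : nat;
  tm_nst : nat;
  tm_start : 'I_(tm_nst.+1);
  tm_halt : pred 'I_(tm_nst.+1);
  tm_delta : 'I_(tm_nst.+1) -> 'I_(tm_nsym.+3) ->
             'I_(tm_nst.+1) * 'I_(tm_nsym.+3) * move }.

Arguments tm_start M : clear implicits, rename.
Arguments tm_halt M : clear implicits, rename.
Arguments tm_delta M : clear implicits, rename.

Notation tsym M := 'I_((tm_nsym M).+3).
Notation tstate M := 'I_((tm_nst M).+1).

(** A configuration is a finite string over the cell alphabet
    [tsym M + tstate M * tsym M]: the tape contents, where exactly one cell
    is marked with the internal state (this marks the head position). *)
Notation cell M := (tsym M + tstate M * tsym M)%type.

Definition blank (M : TM) : tsym M := ord0.
Arguments blank M : clear implicits, rename.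

Definition is_head (M : TM) (c : cell M) : bool :=
  if c is inr _ then true else false.

Definition wf_config (M : TM) (w : seq (cell M)) : bool :=
  count (@is_head M) w == 1.

Definition mark (M : TM) (q : tstate M) (c : cell M) : cell M :=
  match c with inl b => inr (q, b) | inr (_, b) => inr (q, b) end.

Definition cell_sym (M : TM) (c : cell M) : tsym M :=
  match c with inl a => a | inr (_, a) => a end.

Definition tm_step (M : TM) (w : seq (cell M)) : seq (cell M) :=
  let i := find (@is_head M) w in
  let l := take i w in
  match drop i w with
  | inr (q, a) :: r =>
      if tm_halt M q then w else
      let '(q', a', mv) := tm_delta M q a in
      match mv with
      | MoveS => l ++ inr (q', a') :: r
      | MoveR => l ++ inl a' :: (match r with
                                 | [::] => [:: inr (q', blank M)]
                                 | c :: r' => mark q' c :: r' end)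
      | MoveL => match rev l with
                 | [::] => inr (q', blank M) :: inl a' :: r
                 | c :: l' => rev l' ++ mark q' c :: inl a' :: r end
      end
  | _ => w
  end.

Definition tm_halted (M : TM) (w : seq (cell M)) : bool :=
  match drop (find (@is_head M) w) w with
  | inr (q, _) :: _ => tm_halt M q
  | _ => false
  end.

Definition tm_init (M : TM) (x : seq (tsym M)) : seq (cell M) :=
  match x with
  | [::] => [:: inr (tm_start M, blank M)]
  | a :: r => inr (tm_start M, a) :: map inl r
  end.

Definition tm_output (M : TM) (w : seq (cell M)) : seq (tsym M) :=
  let syms := map (@cell_sym M) (drop (find (@is_head M) w) w) in
  take (find (fun a => a == blank M) syms) syms.

Definition tm_halts (M : TM) (x : seq (tsym M)) : Prop :=
  exists t, tm_halted (iter t (@tm_step M) (tm_init x)).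

Definition tm_result (M : TM) (x y : seq (tsym M)) : Prop :=
  exists t, tm_halted (iter t (@tm_step M) (tm_init x)) /\
            tm_output (iter t (@tm_step M) (tm_init x)) = y.

Definition code_bool (M : TM) (b : bool) : tsym M :=
  if b then inord 2 else inord 1.
Arguments code_bool M b : clear implicits, rename.

Definition universal_TM (U : TM) : Prop :=
  forall M : TM, exists p : seq (tsym U), forall x : seq bool,
    (tm_halts (map (code_bool M) x) <->
     tm_halts (p ++ map (code_bool U) x)) /\
    (forall y : seq bool,
       tm_result (map (code_bool M) x) (map (code_bool M) y) <->
       tm_result (p ++ map (code_bool U) x) (map (code_bool U) y)).

Definition computable_nat (u : nat -> nat) : Prop :=
  exists M : TM, forall n,
    tm_result (nseq n (code_bool M true)) (nseq (u n) (code_bool M true)).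

Definition bin_val (bs : seq bool) : nat :=
  foldr (fun (b : bool) acc => b + 2 * acc) 0 bs.

Definition computable_real (x : R) : Prop :=
  exists M : TM, forall n, exists (sgn : bool) (bits : seq bool),
    tm_result (nseq n (code_bool M true)) (map (code_bool M) (sgn :: bits)) /\
    (Rabs (x - (if sgn then (-1)%R else 1%R) * INR (bin_val bits) / (2 ^ n))
       <= Rinv (2 ^ n))%R.

Inductive pexpr (n : nat) :=
| PVar of 'I_n
| PConst of nat
| PInt of Z
| PAdd of pexpr n & pexpr n
| PMul of pexpr n & pexpr n
| PNeg of pexpr n.

Fixpoint peval (n : nat) (cs : seq R) (env : 'I_n -> R) (p : pexpr n) : R :=
  match p with
  | PVar i => env i
  | PConst j => nth 0%R cs j
  | PInt z => IZR z
  | PAdd p1 p2 => (peval cs env p1 + peval cs env p2)%R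
  | PMul p1 p2 => (peval cs env p1 * peval cs env p2)%R
  | PNeg p1 => (- peval cs env p1)%R
  end.

Inductive sa_atom (n : nat) :=
| AZero of pexpr n
| APos of pexpr n.

Definition atom_holds (n : nat) (cs : seq R) (env : 'I_n -> R) (a : sa_atom n) : Prop :=
  match a with
  | AZero p => peval cs env p = 0%R
  | APos p => (0 < peval cs env p)%R
  end.

(** Semialgebraic formula in disjunctive normal form. *)
Definition sa_formula (n : nat) := seq (seq (sa_atom n)).

Fixpoint conj_holds (n : nat) (cs : seq R) (env : 'I_n -> R) (l : seq (sa_atom n)) : Prop :=
  match l with
  | [::] => True
  | a :: l' => atom_holds cs env a /\ conj_holds cs env l'
  end.

Fixpoint sa_holds (n : nat) (cs : seq R) (env : 'I_n -> R) (F : sa_formula n) : Prop :=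
  match F with
  | [::] => False
  | c :: F' => conj_holds cs env c \/ sa_holds cs env F'
  end.

(** A hybrid BSS machine with discrete alphabet A: finitely many control
    states, a real tape (indexed by Z) and a discrete tape over A (indexed by
    Z), each with its own head.  In one step the machine reads its state, the
    discrete symbol under the discrete head and the window of hb_win real
    cells starting at the real head, and (via hb_delta) chooses a new state,
    writes a discrete symbol and new values in the real window, and moves
    both heads. *)
Record HBSS (A : Type) := {
  hb_nst : nat;
  hb_win : nat;
  hb_start : 'I_(hb_nst.+1);
  hb_halt : pred 'I_(hb_nst.+1);
  hb_consts : seq R;
  hb_delta : 'I_(hb_nst.+1) -> A -> ('I_hb_win -> R) ->
             ('I_(hb_nst.+1) * A * move * move) * ('I_hb_win -> R) }.

Arguments hb_start {A} M : rename.
Arguments hb_halt {A} M : rename.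
Arguments hb_consts {A} M : rename.
Arguments hb_delta {A} M : rename.
Arguments hb_nst {A} M : rename.
Arguments hb_win {A} M : rename.

Definition join_env (w : nat) (x y : 'I_w -> R) : 'I_(w + w) -> R :=
  fun i => match split i with inl j => x j | inr j => y j end.

(** BSS_C condition: the transition function is semialgebraic (for each
    state, symbol read and discrete outcome the graph of the real part is a
    semialgebraic subset of R^(2 win) defined with the machine constants),
    and all machine constants are computable reals. *)
Definition BSSC (A : Type) (M : HBSS A) : Prop :=
  (forall c, List.In c (hb_consts M) -> computable_real c) /\
  (forall q a o, exists F : sa_formula (hb_win M + hb_win M),
     forall x y : 'I_(hb_win M) -> R,
       ((hb_delta M q a x).1 = o /\ forall j, (hb_delta M q a x).2 j = y j) <->
       sa_holds (hb_consts M) (join_env x y) F).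

Definition hconf (A : Type) (M : HBSS A) :=
  ('I_((hb_nst M).+1) * (Z -> R) * Z * (Z -> A) * Z)%type.

Definition mv_z (m : move) : Z :=
  match m with MoveL => (-1)%Z | MoveS => 0%Z | MoveR => 1%Z end.

Definition hb_step (A : Type) (M : HBSS A) (c : hconf M) : hconf M :=
  let '(q, rt, rh, dt, dh) := c in
  if hb_halt M q then c else
  let x := fun j : 'I_(hb_win M) => rt (rh + Z.of_nat j)%Z in
  let '((q', a', mr, md), y) := hb_delta M q (dt dh) x in
  let rt' := fun z : Z =>
     if (rh <=? z)%Z then
       match insub (Z.to_nat (z - rh)) : option 'I_(hb_win M) with
       | Some j => y j | None => rt z end
     else rt z in
  let dt' := fun z : Z => if (z =? dh)%Z then a' else dt z in
  (q', rt', (rh + mv_z mr)%Z, dt', (dh + mv_z md)%Z).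

Definition hb_run (A : Type) (M : HBSS A) (t : nat) (c : hconf M) : hconf M :=
  iter t (@hb_step A M) c.

Definition hc_state (A : Type) (M : HBSS A) (c : hconf M) := c.1.1.1.1.
Definition hc_rtape (A : Type) (M : HBSS A) (c : hconf M) := c.1.1.1.2.
Definition hc_dtape (A : Type) (M : HBSS A) (c : hconf M) := c.1.2.

Definition halts_at (A : Type) (M : HBSS A) (c : hconf M) (t : nat) : Prop :=
  hb_halt M (hc_state (hb_run t c)) /\
  forall t', t' < t -> ~~ hb_halt M (hc_state (hb_run t' c)).

Definition diverges (A : Type) (M : HBSS A) (c : hconf M) : Prop :=
  forall t, ~~ hb_halt M (hc_state (hb_run t c)).

(** Discrete alphabet of the hybrid machines: blank (None), the cell
    alphabet of U (input/output letters), and k auxiliary work symbols. *)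
Notation halpha U k := (option (cell U + 'I_k)%type).

Definition point := (R * R)%type.

Definition init_word (U : TM) (k : nat) (M : HBSS (halpha U k))
    (w : seq (cell U)) : hconf M :=
  (hb_start M, (fun _ => 0%R), 0%Z,
   (fun z : Z => if (0 <=? z)%Z then
       nth None [seq Some (inl c) | c <- w] (Z.to_nat z) else None), 0%Z).

Definition init_point (U : TM) (k : nat) (M : HBSS (halpha U k))
    (x : point) : hconf M :=
  (hb_start M,
   (fun z : Z => if (z =? 0)%Z then x.1 else if (z =? 1)%Z then x.2 else 0%R),
   0%Z, (fun _ => None), 0%Z).

Definition dout (U : TM) (k : nat) (dt : Z -> halpha U k) (w : seq (cell U)) : Prop :=
  [seq dt (Z.of_nat i) | i <- iota 0 (size w)] = [seq Some (inl c) | c <- w] /\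
  forall c, dt (Z.of_nat (size w)) <> Some (inl c).

Definition in_disk (p : point) : Prop := (p.1 ^ 2 + p.2 ^ 2 <= 1)%R.

Definition computes_E (U : TM) (k : nat) (M : HBSS (halpha U k))
    (E : seq (cell U) -> point) : Prop :=
  forall w, wf_config w -> exists t, halts_at (init_word M w) t /\
    (hc_rtape (hb_run t (init_word M w)) 0%Z,
     hc_rtape (hb_run t (init_word M w)) 1%Z) = E w.

Definition time_E (U : TM) (k : nat) (M : HBSS (halpha U k))
    (bound : nat -> nat) : Prop :=
  forall w, wf_config w -> forall t, halts_at (init_word M w) t -> t <= bound (size w).

Definition computes_D (U : TM) (k : nat) (M : HBSS (halpha U k))
    (D : point -> option (seq (cell U))) : Prop :=
  forall x, in_disk x ->
    (D x = None -> diverges (init_point M x)) /\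
    (forall w, D x = Some w -> exists t, halts_at (init_point M x) t /\
        dout (hc_dtape (hb_run t (init_point M x))) w).

Definition time_D (U : TM) (k : nat) (M : HBSS (halpha U k))
    (D : point -> option (seq (cell U))) (bound : nat -> nat) : Prop :=
  forall x w, in_disk x -> D x = Some w ->
    forall t, halts_at (init_point M x) t -> t <= bound (size w).

Definition computes_tau (U : TM) (k : nat) (M : HBSS (halpha U k))
    (tau : point -> option nat) : Prop :=
  forall x, in_disk x ->
    (tau x = None -> diverges (init_point M x)) /\
    (forall n, tau x = Some n -> exists t, halts_at (init_point M x) t /\
        hc_rtape (hb_run t (init_point M x)) 0%Z = INR n).

Definition dist2 (p q : point) : R := ((p.1 - q.1) ^ 2 + (p.2 - q.2) ^ 2)%R.

Definition open2 (U : point -> Prop) : Prop :=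
  forall p, U p -> exists e, (0 < e)%R /\ forall q, (dist2 p q < e ^ 2)%R -> U q.

Definition connected2 (K : point -> Prop) : Prop :=
  ~ exists U V : point -> Prop, open2 U /\ open2 V /\
      (forall p, K p -> U p \/ V p) /\ (exists p, K p /\ U p) /\
      (exists p, K p /\ V p) /\ (forall p, K p -> U p -> V p -> False).

Definition disk_interior (C : point -> Prop) : point -> Prop :=
  fun p => C p /\ exists e, (0 < e)%R /\
      forall q, in_disk q -> (dist2 p q < e ^ 2)%R -> C q.

Definition disk_closure (C : point -> Prop) : point -> Prop :=
  fun p => in_disk p /\ forall e, (0 < e)%R ->
      exists q, C q /\ (dist2 p q < e ^ 2)%R.

Definition continuous2 (g : R -> R -> R) (x y : R) : Prop :=
  forall e, (0 < e)%R -> exists d, (0 < d)%R /\ forall x' y',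
    (dist2 (x', y') (x, y) < d ^ 2)%R -> (Rabs (g x' y' - g x y) < e)%R.

(** C^infinity on R^2: there is a family F w (w a word over {x,y}) of
    iterated partial derivatives, all existing everywhere and continuous. *)
Definition smooth2 (g : R -> R -> R) : Prop :=
  exists F : seq bool -> R -> R -> R, F [::] = g /\
    forall w x y,
      derivable_pt_lim (fun s => F w s y) x (F (false :: w) x y) /\
      derivable_pt_lim (fun s => F w x s) y (F (true :: w) x y) /\
      continuous2 (F w) x y.

Definition smooth_disk_map (f : point -> point) : Prop :=
  (forall p, in_disk p -> in_disk (f p)) /\
  exists g1 g2 : R -> R -> R, smooth2 g1 /\ smooth2 g2 /\
    forall p, in_disk p -> f p = (g1 p.1 p.2, g2 p.1 p.2).

Definition Cset (U : TM) (D : point -> option (seq (cell U))) (w : seq (cell U))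
  : point -> Prop := fun p => in_disk p /\ D p = Some w.

Definition is_CDS (U : TM) (f : point -> point) (E : seq (cell U) -> point)
    (D : point -> option (seq (cell U))) (tau : point -> option nat)
    (t : nat -> nat) : Prop :=
  (forall p, in_disk p -> in_disk (f p)) /\
  (forall w, wf_config w -> in_disk (E w)) /\
  (forall x w, in_disk x -> D x = Some w -> wf_config w) /\
  (exists k (M : HBSS (halpha U k)), BSSC M /\ computes_E M E /\
     exists c, time_E M (fun n => c * t n + c)) /\
  (exists k (M : HBSS (halpha U k)), BSSC M /\ computes_D M D /\
     exists c, time_D M D (fun n => c * t n + c)) /\
  (forall x, in_disk x -> (tau x = None <-> D x = None)) /\
  (forall w (K : point -> Prop), connected2 K -> (forall p, K p -> Cset D w p) ->
     forall p q, K p -> K q -> tau p = tau q) /\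
  (exists u, computable_nat u /\
     exists k (M : HBSS (halpha U k)), BSSC M /\ computes_tau M tau /\
       exists c, time_D M D (fun n => c * u n + c)) /\
  (forall w, wf_config w -> D (E w) = Some w) /\
  (forall w x, wf_config w -> Cset D w x ->
     exists n, tau x = Some n /\ D (iter n f x) = Some (tm_step w)).

Definition robust_CDS (U : TM) (E : seq (cell U) -> point)
    (D : point -> option (seq (cell U))) : Prop :=
  forall w, wf_config w ->
    (forall p, Cset D w p <-> disk_closure (disk_interior (Cset D w)) p) /\
    disk_interior (Cset D w) (E w).

Definition E_lower_linear (U : TM) (E : seq (cell U) -> point) : Prop :=
  forall k (M : HBSS (halpha U k)), BSSC M -> computes_E M E ->
    exists c N : nat, forall n, N <= n -> exists w, wf_config w /\ size w = n /\
      forall t, halts_at (init_word M w) t -> n <= c * t.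

Definition D_lower_linear (U : TM) (D : point -> option (seq (cell U))) : Prop :=
  forall k (M : HBSS (halpha U k)), BSSC M -> computes_D M D ->
    exists c N : nat, forall n, N <= n -> exists x w, in_disk x /\ D x = Some w /\
      size w = n /\ forall t, halts_at (init_point M x) t -> n <= c * t.

(* Main.v *)
Require Import Defs.
From Stdlib Require Import Reals ZArith Lra Lia Classical ClassicalEpsilon FunctionalExtensionality.
From mathcomp Require Import ssreflect ssrfun ssrbool eqtype ssrnat seq choice fintype div.
From mathcomp Require Import zify.
Set Implicit Arguments. Unset Strict Implicit. Unset Printing Implicit Defensive.

(** The dynamics is Moore's generalized shift.  A configuration is a pair of
    stacks, the head cell lying on top of the right one, and a stack is coded by
    a real number: the empty stack by 0, and a letter of index i on top of a
    stack of code t by (i + t) / W, so that pushing and popping are affine.  The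
    codes of stacks are thickened to intervals by letting the innermost 0 vary
    in [-1/(4W), 1/(4W)], and C_w is the rectangle around the code of w.  A step
    of the machine depends on the topmost letters only, hence acts on these
    rectangles by finitely many affine maps; glued together with plateau
    functions they give a smooth map, a sum of products u(x) v(y).

    The universal machine keeps a program, some erased cells and a queue on its
    tape.  Every Turing machine is simulated by a queue automaton, which rotates
    its tape in order to move the head to the left.  The program is the
    transition table of that automaton: to look up an entry, the unary codes at
    the front of the queue are consumed while a mark advances from entry to
    entry. *)

(** * Turing machines on split tapes *)

(** Universality, as defined, prescribes the format: the raw bits of the input follow the program
    directly, with no end marker, and the result must stand in the same letters between the head and
    the first blank. This is why the simulated data form a queue at the right end of the tape, where
    the input already lies and letters can be appended without limit, and why a bit is a single
    letter of that queue. Robustness with slowdown 1 asks that one application of the map send each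
    whole rectangle into the next one. The tolerance sits below the innermost letter, so the size of
    a rectangle depends on the stack heights only, and pushes, pops and replacements leave the
    innermost remainder as it is. The linear lower bounds hold although one real cell can store a
    whole configuration: the discrete head still has to visit the cells of the word that it reads or
    writes. *)

Section SplitTape.
Variables (Q G : Type) (bl : G) (hlt : Q -> bool) (dlt : Q -> G -> Q * G * move).

(* [(l, q, r)]: [l] is the tape to the left of the head, nearest cell first;
   [r] starts with the scanned cell, and [r = [::]] stands for a blank one. *)
Definition sconf := (seq G * Q * seq G)%type.

Definition sstep (c : sconf) : sconf :=
  let: (l, q, r) := c in
  if hlt q then c else
  let: (q', a', mv) := dlt q (head bl r) in
  match mv with
  | MoveS => (l, q', a' :: behead r)
  | MoveR => (a' :: l, q', behead r)
  | MoveL => match l with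
             | [::] => ([::], q', bl :: a' :: behead r)
             | c :: l' => (l', q', c :: a' :: behead r)
             end
  end.

Definition reach (c c' : sconf) := exists n, iter n sstep c = c'.
(** At least one step. When halting is carried back from the universal machine to the simulated one,
    this makes the remaining time decrease. *)
Definition reach1 (c c' : sconf) := exists n, iter n.+1 sstep c = c'.

Lemma reach_refl c : reach c c. Proof. by exists 0. Qed.

Lemma reach_trans c1 c2 c3 : reach c1 c2 -> reach c2 c3 -> reach c1 c3.
Proof. by move=> [n <-] [m <-]; exists (m + n); rewrite iterD. Qed.

Lemma reach1_trans c1 c2 c3 : reach1 c1 c2 -> reach c2 c3 -> reach1 c1 c3.
Proof. by move=> [n <-] [m <-]; exists (m + n); rewrite -addnS iterD. Qed.

Lemma reach_trans1 c1 c2 c3 : reach c1 c2 -> reach1 c2 c3 -> reach1 c1 c3.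
Proof. by move=> [n <-] [m <-]; exists (m + n); rewrite -addSn iterD. Qed.

Lemma reach1W c c' : reach1 c c' -> reach c c'.
Proof. by move=> [n E]; exists n.+1. Qed.

Lemma step_reach c c' c'' : sstep c = c' -> reach c' c'' -> reach c c''.
Proof. by move=> E; apply: reach_trans; exists 1. Qed.

Lemma step_reach1 c c' c'' : sstep c = c' -> reach c' c'' -> reach1 c c''.
Proof. by move=> E; apply: reach1_trans; exists 0. Qed.

Lemma walk_right q (P : pred G) l s r : ~~ hlt q ->
  (forall a, P a -> dlt q a = (q, a, MoveR)) -> all P s ->
  reach (l, q, s ++ r) (rev s ++ l, q, r).
Proof.
move=> nh H; elim: s l => [|a s IH] l /=; first by exists 0.
case/andP=> Pa /(IH (a :: l)); rewrite rev_cons cat_rcons.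
by apply: step_reach; rewrite /= (negbTE nh) H.
Qed.

Lemma walk_left q (P : pred G) l d s r : ~~ hlt q ->
  (forall a, P a -> dlt q a = (q, a, MoveL)) -> all P (head bl r :: s) ->
  reach (s ++ d :: l, q, r) (l, q, d :: rev s ++ head bl r :: behead r).
Proof.
move=> nh H; elim: s r => [|a s IH] r /= /andP [Pr Ps].
  by exists 1; rewrite /= (negbTE nh) H.
rewrite rev_cons cat_rcons.
apply: (step_reach (c' := (s ++ d :: l, q, a :: head bl r :: behead r))).
  by rewrite /= (negbTE nh) H.
exact: (IH (a :: head bl r :: behead r)).
Qed.

(** The pattern of the return trips of the universal machine: one writing step at the right end,
    then a walk in a state that leaves the swept cells alone, up to the cell [d] where the sweep is
    meant to stop. *)
Lemma turn_left q0 q (P : pred G) l d s r a' : ~~ hlt q0 -> ~~ hlt q ->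
  dlt q0 (head bl r) = (q, a', MoveL) ->
  (forall a, P a -> dlt q a = (q, a, MoveL)) -> all P s ->
  reach (s ++ d :: l, q0, r) (l, q, d :: rev s ++ a' :: behead r).
Proof.
move=> nh0 nh E H; case: s => [|c s] Ps.
  by exists 1; rewrite /= (negbTE nh0) E.
apply: (step_reach (c' := (s ++ d :: l, q, c :: a' :: behead r))).
  by rewrite /= (negbTE nh0) E.
by rewrite rev_cons cat_rcons; exact: (walk_left (r := c :: a' :: behead r) l d nh H Ps).
Qed.

Lemma iter_halted n c : hlt c.1.2 -> iter n sstep c = c.
Proof. by case: c => [[l q] r] /= h; elim: n => //= n ->; rewrite /= h. Qed.

End SplitTape.

Section SplitTapeTM.
Variable M : TM.

Definition mstep := sstep (blank M) (tm_halt M) (tm_delta M).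

Definition tword (c : sconf (tstate M) (tsym M)) : seq (cell M) :=
  let: (l, q, r) := c in
  map inl (rev l) ++ inr (q, head (blank M) r) :: map inl (behead r).

Lemma find_tword l c (r : seq (cell M)) :
  find (@is_head M) (map inl l ++ inr c :: r) = size l.
Proof. by elim: l => //= a l ->. Qed.

Lemma take_tword l c (r : seq (cell M)) :
  take (size l) (map inl l ++ inr c :: r) = map inl l.
Proof. by rewrite -(size_map (@inl _ (tstate M * tsym M)) l) take_size_cat. Qed.

Lemma drop_tword l c (r : seq (cell M)) :
  drop (size l) (map inl l ++ inr c :: r) = inr c :: r.
Proof. by rewrite -(size_map (@inl _ (tstate M * tsym M)) l) drop_size_cat. Qed.

(** Moving right off the end leaves an empty right part in [sstep] and appends a blank cell in
    [tm_step]; the two agree because [tword] prints an empty right part as one blank. *)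
Lemma tm_step_tword c : tm_step (tword c) = tword (mstep c).
Proof.
case: c => [[l q] r]; rewrite /tm_step /tword /mstep /sstep.
rewrite find_tword take_tword drop_tword.
case: (tm_halt M q) => //.
case: (tm_delta M q (head (blank M) r)) => [[q' a'] []] //=.
- case: l => [|c l] //=.
  by rewrite -map_rev revK /= map_rev.
- by rewrite rev_cons map_rcons cat_rcons; case: r => [|a [|b r]].
Qed.

Lemma iter_tm_step_tword n c :
  iter n (@tm_step M) (tword c) = tword (iter n mstep c).
Proof. by elim: n => //= n ->; rewrite tm_step_tword. Qed.

Lemma tm_halted_tword c : tm_halted (tword c) = tm_halt M c.1.2.
Proof. by case: c => [[l q] r]; rewrite /tm_halted /tword find_tword drop_tword. Qed.

Lemma tm_output_tword l q r : tm_output (tword (l, q, r)) =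
  take (find (pred1 (blank M)) r) r.
Proof.
rewrite /tm_output /tword find_tword drop_tword /= -map_comp.
rewrite (eq_map (g := id)) // map_id.
by case: r => [|a r] //=; rewrite eqxx.
Qed.

Lemma tm_init_tword x : tm_init x = tword ([::], tm_start M, x).
Proof. by case: x. Qed.

Lemma wf_tword w : wf_config w ->
  exists l q a r, w = tword (l, q, a :: r).
Proof.
rewrite /wf_config /= => H.
suff [l [q [a [r ->]]]] : exists l q a r, w = map inl l ++ inr (q, a) :: map inl r.
  by exists (rev l), q, a, r; rewrite /= revK.
have noh (v : seq (cell M)) : count (@is_head M) v = 0 -> exists r, v = map inl r.
  elim: v => [|[a|qa] v IH] //=; first by exists [::].
  by rewrite add0n => /IH [r ->]; exists (a :: r).
elim: w H => [|[a|[q a]] w IH] //=.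
  by rewrite add0n => /IH [l [q [b [r ->]]]]; exists (a :: l), q, b, r.
rewrite add1n eqSS => /eqP /noh [r ->].
by exists [::], q, a, r.
Qed.

Lemma tword_wf c : wf_config (tword c).
Proof.
case: c => [[l q] r]; rewrite /wf_config /tword count_cat /= !count_map.
have E : forall s : seq (tsym M), count (preim inl (@is_head M)) s = 0.
  by elim=> //= a s ->.
by rewrite !E.
Qed.

End SplitTapeTM.

(** * A universal machine interpreting queue programs *)

(* Letters of the simulated queue; [DK] is a tick of a unary code, [D1] and
   [D2] are the raw input bits. *)
Inductive dsym := D0 | D1 | D2 | DK | DS.

(* [App d] appends [d] to the queue, [PT] pushes a tick in front of it, [SEL]
   ends an entry: it consumes a unary code at the front of the queue and
   jumps to the entry with that number. *)
Inductive op := App of dsym | PT | SEL | HLT.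

(* The Boolean of [Op] is the mark by which the machine finds its way back to
   the current instruction; [X] fills the room between program and queue. *)
Inductive usym := B | Dt of dsym | X | LE | Op of op & bool.

Inductive ustate :=
  | Exec | Appd of dsym | Ret | Push | Push1 | Sel0 | Sel1 | Sel2 | SelRet
  | Adv | SelGo | Hlt1 | Hlt2 | Hlt3 | Halt.

Definition uhalt q := if q is Halt then true else false.

Definition udelta (q : ustate) (a : usym) : ustate * usym * move :=
  match q, a with
  | Exec, Op (App d) _ => (Appd d, Op (App d) true, MoveR)
  | Exec, Op PT _ => (Push, Op PT true, MoveR)
  | Exec, Op SEL _ => (Sel0, a, MoveL)
  | Exec, Op HLT _ => (Hlt1, a, MoveR)
  | Exec, _ => (Exec, a, MoveR)
  | Appd d, B => (Ret, Dt d, MoveL)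
  | Appd d, _ => (q, a, MoveR)
  | Ret, Op o true => (Exec, Op o false, MoveR)
  | Ret, _ => (Ret, a, MoveL)
  | Push, (Op _ _ | X) => (Push, a, MoveR)
  | Push, _ => (Push1, a, MoveL)
  | Push1, _ => (Ret, Dt DK, MoveL)
  | Sel0, LE => (Sel1, LE, MoveR)
  | Sel0, _ => (Sel0, a, MoveL)
  | Sel1, Op o _ => (Sel2, Op o true, MoveR)
  | Sel2, (Op _ _ | X) => (Sel2, a, MoveR)
  | Sel2, Dt DK => (SelRet, X, MoveL)
  | Sel2, Dt DS => (SelRet, Dt D2, MoveL)
  | Sel2, Dt D2 => (SelRet, Dt D1, MoveL)
  | Sel2, Dt D1 => (SelRet, Dt D0, MoveL)
  | Sel2, Dt D0 => (SelGo, X, MoveL)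
  | SelRet, Op o true => (Adv, Op o false, MoveS)
  | SelRet, _ => (SelRet, a, MoveL)
  | Adv, Op SEL _ => (Sel1, a, MoveR)
  | Adv, _ => (Adv, a, MoveR)
  | SelGo, Op o true => (Exec, Op o false, MoveS)
  | SelGo, _ => (SelGo, a, MoveL)
  | Hlt1, (Op _ _ | X) => (Hlt1, a, MoveR)
  | Hlt1, _ => (Hlt2, a, MoveS)
  | Hlt2, Dt (D1 | D2) => (Hlt2, a, MoveR)
  | Hlt2, Dt (D0 | DS) => (Hlt3, B, MoveL)
  | Hlt2, _ => (Hlt3, a, MoveL)
  | Hlt3, X => (Halt, X, MoveR)
  | Hlt3, _ => (Hlt3, a, MoveL)
  | _, _ => (q, a, MoveS)
  end.

Notation ureach := (reach B uhalt udelta).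
Notation ureach1 := (reach1 B uhalt udelta).

(** * Effect of the single instructions *)

Definition uop o := Op o false.
Definition lprog pre := rev (map uop pre) ++ [:: LE].
Definition uconf pre q ops m ds : sconf ustate usym :=
  (lprog pre, q, map uop ops ++ nseq m X ++ map Dt ds).

Definition unmarked a := if a is Op _ true then false else true.
Definition nonblank a := if a is B then false else true.
Definition op_or_X a := if a is (Op _ _ | X) then true else false.
Definition nonLE a := if a is LE then false else true.
Definition nonX a := if a is X then false else true.

Lemma all_uop (P : pred usym) ops : (forall o, P (uop o)) -> all P (map uop ops).
Proof. by move=> H; elim: ops => //= o ops ->; rewrite H. Qed.

Lemma all_nseqX (P : pred usym) m : P X -> all P (nseq m X).
Proof. by move=> H; rewrite all_nseq H orbT. Qed.

Lemma all_Dt (P : pred usym) ds : (forall d, P (Dt d)) -> all P (map Dt ds).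
Proof. by move=> H; elim: ds => //= o ops ->; rewrite H. Qed.

Lemma lprog_rcons pre o : lprog (rcons pre o) = uop o :: lprog pre.
Proof. by rewrite /lprog map_rcons rev_rcons. Qed.

Lemma exec_App pre d ops m ds :
  ureach1 (uconf pre Exec (App d :: ops) m ds)
          (uconf (rcons pre (App d)) Exec ops m (rcons ds d)).
Proof.
pose l := Op (App d) true :: lprog pre.
pose r := map uop ops ++ nseq m X ++ map Dt ds.
apply: (step_reach1 (c' := (l, Appd d, r))); first by [].
have nbr : all nonblank r.
  by rewrite !all_cat all_uop ?all_nseqX ?all_Dt.
have umr : all unmarked (rev r).
  by rewrite all_rev !all_cat all_uop ?all_nseqX ?all_Dt.
have W := @walk_right _ _ B uhalt udelta (Appd d) nonblank l r [::] isT.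
rewrite cats0 in W; apply: reach_trans (W _ nbr) _; first by case.
have T := @turn_left _ _ B uhalt udelta (Appd d) Ret unmarked
   (lprog pre) (Op (App d) true) (rev r) [::] (Dt d) isT isT erefl _ umr.
apply: reach_trans (T _) _.
  by case=> // o [].
apply: step_reach; first by [].
rewrite /uconf lprog_rcons map_rcons revK /r -cats1 !catA.
exact: reach_refl.
Qed.

(** [Push] runs to the first queue letter and [Push1] overwrites the erased cell before it; hence
    the erased cell and the non-empty queue in the statement. *)
Lemma exec_PT pre ops m d ds :
  ureach1 (uconf pre Exec (PT :: ops) m.+1 (d :: ds))
          (uconf (rcons pre PT) Exec ops m (DK :: d :: ds)).
Proof.
pose l := Op PT true :: lprog pre.
pose s := map uop ops ++ nseq m.+1 X.
apply: (step_reach1 (c' := (l, Push, s ++ map Dt (d :: ds)))).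
  by rewrite /s -catA.
have ox : all op_or_X s by rewrite all_cat all_uop ?all_nseqX.
apply: reach_trans (@walk_right _ _ B uhalt udelta Push op_or_X l s _ isT _ ox) _.
  by case.
have -> : rev s ++ l = X :: rev (map uop ops ++ nseq m X) ++ l.
  by rewrite /s -[in nseq m.+1 X]addn1 nseqD catA rev_cat.
apply: step_reach; first by [].
have um : all unmarked (rev (map uop ops ++ nseq m X)).
  by rewrite all_rev !all_cat all_uop ?all_nseqX.
have T := @turn_left _ _ B uhalt udelta Push1 Ret unmarked
   (lprog pre) (Op PT true) _ (X :: map Dt (d :: ds)) (Dt DK) isT isT erefl _ um.
apply: reach_trans (T _) _.
  by case=> // o [].
apply: step_reach; first by [].
rewrite /uconf lprog_rcons revK -!catA.
exact: reach_refl.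
Qed.

Lemma exec_SEL pre ops m ds :
  ureach1 (uconf pre Exec (SEL :: ops) m ds)
          (uconf [::] Sel1 (pre ++ SEL :: ops) m ds).
Proof.
rewrite /reach1.
suff : ureach (uconf pre Exec (SEL :: ops) m ds)
          (uconf [::] Sel1 (pre ++ SEL :: ops) m ds) by case=> [[|n] H] //; exists n.
have T := @turn_left _ _ B uhalt udelta Exec Sel0 nonLE
   [::] LE (rev (map uop pre)) (map uop (SEL :: ops) ++ nseq m X ++ map Dt ds) (uop SEL) isT isT erefl _ _.
apply: reach_trans (T _ _) _; first by case.
  by rewrite all_rev all_uop.
apply: step_reach; first by [].
rewrite revK /uconf map_cat -catA; exact: reach_refl.
Qed.

(* The first instruction of the current entry is marked before the head leaves
   for the front letter of the queue; [a] replaces that letter. *)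
Lemma sel_mark q pre o ops m d ds a : 
  udelta Sel2 (Dt d) = (q, a, MoveL) -> (q = SelRet \/ q = SelGo) ->
  ureach (lprog pre, Sel1, map uop (o :: ops) ++ nseq m X ++ map Dt (d :: ds))
   (lprog pre, q, Op o true :: map uop ops ++ nseq m X ++ a :: map Dt ds).
Proof.
move=> E Q; pose s := map uop ops ++ nseq m X.
apply: (step_reach (c' := (Op o true :: lprog pre, Sel2, s ++ map Dt (d :: ds)))).
  by rewrite /s -catA.
have ox : all op_or_X s by rewrite all_cat all_uop ?all_nseqX.
apply: reach_trans (@walk_right _ _ B uhalt udelta Sel2 op_or_X _ s _ isT _ ox) _.
  by case.
have um : all unmarked (rev s).
  by rewrite all_rev !all_cat all_uop ?all_nseqX.
have nh : ~~ uhalt q by case: Q => ->.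
have T := @turn_left _ _ B uhalt udelta Sel2 q unmarked
   (lprog pre) (Op o true) (rev s) (map Dt (d :: ds)) _ isT nh E _ um.
apply: reach_trans (T _) _.
  by case: Q => -> [] // ? [].
rewrite revK /s -catA; exact: reach_refl.
Qed.

Lemma nseqSr_cat (T : Type) m (x : T) s : nseq m x ++ x :: s = nseq m.+1 x ++ s.
Proof. by elim: m => //= m ->. Qed.

Definition nonSEL o := if o is SEL then false else true.
Definition nonSELu a := if a is Op SEL _ then false else true.

Lemma adv_entry pre body rest m ds : all nonSEL body ->
  ureach (uconf pre Adv (body ++ SEL :: rest) m ds)
         (uconf (pre ++ rcons body SEL) Sel1 rest m ds).
Proof.
move=> nb; rewrite /uconf map_cat -catA.
have nbu : all nonSELu (map uop body) by elim: body nb => //= -[] //= d s IH /IH.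
have T := @walk_right _ _ B uhalt udelta Adv nonSELu (lprog pre) _
  (map uop (SEL :: rest) ++ nseq m X ++ map Dt ds) isT _ nbu.
apply: reach_trans (T _) _; first by case=> // -[].
apply: step_reach; first by [].
rewrite /lprog map_cat map_rcons rev_cat rev_rcons /= -catA; exact: reach_refl.
Qed.

(** * Programs as lists of entries, and jumps between entries *)

Definition prog (bs : seq (seq op)) := flatten [seq rcons b SEL | b <- bs].

Lemma prog_cat bs cs : prog (bs ++ cs) = prog bs ++ prog cs.
Proof. by rewrite /prog map_cat flatten_cat. Qed.

Lemma prog_cons b bs : prog (b :: bs) = b ++ SEL :: prog bs.
Proof. by rewrite /prog /= cat_rcons. Qed.

Lemma prog_rcons bs b : prog (rcons bs b) = prog bs ++ rcons b SEL.
Proof. by rewrite -cats1 prog_cat /prog /= cats0. Qed.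

Section Program.
Variable bs : seq (seq op).
Hypothesis bsP : all (all nonSEL) bs.

Definition at_entry j q m ds := uconf (prog (take j bs)) q (prog (drop j bs)) m ds.

Lemma prog_drop j : j < size bs ->
  prog (drop j bs) = nth [::] bs j ++ SEL :: prog (drop j.+1 bs).
Proof. by move=> lt; rewrite (drop_nth [::]) // prog_cons. Qed.

Lemma prog_drop_cons j : j < size bs ->
  exists o ops, prog (drop j bs) = o :: ops.
Proof. by move/prog_drop => ->; case: (nth _ _ _) => [|o ops]; do 2!eexists. Qed.

Lemma nth_nonSEL j : all nonSEL (nth [::] bs j).
Proof.
case: (ltnP j (size bs)) => lt; last by rewrite nth_default.
by move/all_nthP: bsP; apply.
Qed.

(** Covers both ways to count down by one: a tick becomes an erased cell, so that [m] grows, and a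
    single-letter code is replaced by the next smaller one. *)
Lemma sel_advance j d a m m' ds ds' : j < size bs ->
  udelta Sel2 (Dt d) = (SelRet, a, MoveL) ->
  nseq m X ++ a :: map Dt ds = nseq m' X ++ map Dt ds' ->
  ureach (at_entry j Sel1 m (d :: ds)) (at_entry j.+1 Sel1 m' ds').
Proof.
move=> lt E A; have [o [ops Eo]] := prog_drop_cons lt.
rewrite {1}/at_entry /uconf Eo.
apply: reach_trans (@sel_mark SelRet _ _ _ _ _ _ _ E _) _; first by left.
rewrite A; apply: (step_reach (c' := at_entry j Adv m' ds')).
  by rewrite /at_entry /uconf Eo.
rewrite {1}/at_entry (prog_drop lt).
have := @adv_entry (prog (take j bs)) _ (prog (drop j.+1 bs)) m' ds' (nth_nonSEL j).
by rewrite -prog_rcons -take_nth.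
Qed.

Lemma sel_dec j d d' m ds : j < size bs ->
  udelta Sel2 (Dt d) = (SelRet, Dt d', MoveL) ->
  ureach (at_entry j Sel1 m (d :: ds)) (at_entry j.+1 Sel1 m (d' :: ds)).
Proof. by move=> lt E; exact: sel_advance E _. Qed.

Lemma sel_exec j m ds : j < size bs ->
  ureach (at_entry j Sel1 m (D0 :: ds)) (at_entry j Exec m.+1 ds).
Proof.
move=> lt; have [o [ops Eo]] := prog_drop_cons lt.
rewrite {1}/at_entry /uconf Eo.
have T := @sel_mark SelGo (prog (take j bs)) o ops m D0 ds X erefl (or_intror erefl).
apply: reach_trans T _.
rewrite nseqSr_cat; apply: (step_reach (c' := at_entry j Exec m.+1 ds)).
  by rewrite /at_entry /uconf Eo.
exact: reach_refl.
Qed.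

Lemma sel_ticks j k m ds : j + k < size bs ->
  ureach (at_entry j Sel1 m (nseq k DK ++ ds)) (at_entry (j + k) Sel1 (m + k) ds).
Proof.
elim: k j m => [|k IH] j m; first by rewrite !addn0 => _; exact: reach_refl.
rewrite -[j + k.+1]addSnnS -[m + k.+1]addSnnS => lt.
apply: (reach_trans _ (IH _ m.+1 lt)).
apply: (sel_advance (a := X)) => //; last by rewrite nseqSr_cat.
by apply: ltn_trans lt; rewrite addSn ltnS leq_addr.
Qed.

(** The codes of 0 to 3 are single letters, counted down in place by [Sel2]; this lets the input
    bits, which are the letters 1 and 2, stand raw in the queue. From 4 on the code is unary, ended
    by [D0]. *)
Definition code i : seq dsym :=
  match i with
  | 0 => [:: D0] | 1 => [:: D1] | 2 => [:: D2] | 3 => [:: DS]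
  | _ => nseq i DK ++ [:: D0]
  end.

Lemma sel_code j i m ds : j + i < size bs ->
  ureach (at_entry j Sel1 m (code i ++ ds)) (at_entry (j + i) Exec (m + size (code i)) ds).
Proof.
case: i => [|[|[|[|i]]]] lt; last first.
  rewrite /code -catA; apply: reach_trans (@sel_ticks _ _ _ _ lt) _.
  rewrite size_cat size_nseq /= addnA addn1; exact: sel_exec.
all: rewrite ?addn1 ?addn0 ?addn2 ?addn3; rewrite ?addn1 ?addn0 ?addn2 ?addn3 in lt.
- apply: (reach_trans (@sel_dec j DS D2 m ds (ltnW (ltnW (ltnW lt))) erefl)).
  apply: (reach_trans (@sel_dec j.+1 D2 D1 m ds (ltnW (ltnW lt)) erefl)).
  apply: (reach_trans (@sel_dec j.+2 D1 D0 m ds (ltnW lt) erefl)).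
  exact: sel_exec.
- apply: (reach_trans (@sel_dec j D2 D1 m ds (ltnW (ltnW lt)) erefl)).
  apply: (reach_trans (@sel_dec j.+1 D1 D0 m ds (ltnW lt) erefl)).
  exact: sel_exec.
- apply: (reach_trans (@sel_dec j D1 D0 m ds (ltnW lt) erefl)).
  exact: sel_exec.
- exact: sel_exec.
Qed.

End Program.

Lemma exec_Apps pre w ops m ds :
  ureach (uconf pre Exec (map App w ++ ops) m ds)
         (uconf (pre ++ map App w) Exec ops m (ds ++ w)).
Proof.
elim: w pre ds => [|d w IH] pre ds /=; first by rewrite !cats0; exact: reach_refl.
apply: reach_trans (reach1W (exec_App _ _ _ _ _)) _.
by have := IH (rcons pre (App d)) (rcons ds d); rewrite !cat_rcons.
Qed.

Lemma exec_PTs pre k ops m d ds :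
  ureach (uconf pre Exec (nseq k PT ++ ops) (m + k) (d :: ds))
         (uconf (pre ++ nseq k PT) Exec ops m (nseq k DK ++ d :: ds)).
Proof.
elim: k pre d ds => [|k IH] pre d ds; first by rewrite addn0 cats0; exact: reach_refl.
rewrite addnS; apply: reach_trans (reach1W (exec_PT _ _ _ _ _)) _.
by have := IH (rcons pre PT) DK (d :: ds); rewrite cat_rcons nseqSr_cat.
Qed.

Lemma exec_goto pre w k ops m ds : ds ++ w <> [::] ->
  ureach1 (uconf pre Exec (map App w ++ nseq k PT ++ SEL :: ops) (m + k) ds)
   (uconf [::] Sel1 (pre ++ map App w ++ nseq k PT ++ SEL :: ops) m
      (nseq k DK ++ ds ++ w)).
Proof.
move=> ne; apply: reach_trans1 (exec_Apps _ _ _ _ _) _.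
case: (ds ++ w) ne => // d ds' _.
apply: reach_trans1 (exec_PTs _ _ _ _ _ _) _.
by have := exec_SEL ((pre ++ map App w) ++ nseq k PT) ops m (nseq k DK ++ d :: ds'); rewrite -!catA.
Qed.

Definition bit b := if b then D2 else D1.
Definition is_bit d := if d is (D1 | D2) then true else false.
Definition is_bitu a := if a is Dt d then is_bit d else false.

(** The output ends at the first blank. After the leading bits, a simulated blank ([D0]) or the end
    of the simulated tape ([DS]) is therefore overwritten by [B]. A tick starts the code of another
    letter; it stays, so that the output is no bit word on either side. The erased cell shows [Hlt3]
    where the queue begins. *)
Lemma exec_HLT pre ops m y d ds : ~~ is_bit d ->
  exists l, ureach (uconf pre Exec (HLT :: ops) m.+1 (map bit y ++ d :: ds))
   (l, Halt, map Dt (map bit y) ++ (if d is DK then Dt DK else B) :: map Dt ds).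
Proof.
move=> nb; eexists; set ds0 := _ ++ _.
pose s := map uop ops ++ nseq m.+1 X.
apply: (step_reach (c' := (uop HLT :: lprog pre, Hlt1, s ++ map Dt ds0))).
  by rewrite /s -catA.
have ox : all op_or_X s by rewrite all_cat all_uop ?all_nseqX.
have W := @walk_right _ _ B uhalt udelta Hlt1 op_or_X (uop HLT :: lprog pre) s (map Dt ds0) isT _ ox.
apply: reach_trans (W _) _; first by case.
set l := rev s ++ _.
apply: (step_reach (c' := (l, Hlt2, map Dt ds0))).
  by rewrite /ds0 /=; case: y {ds0 W} => [|b y] /=; [case: d nb | case: b].
rewrite /ds0 map_cat.
have bu : all is_bitu (map Dt (map bit y)) by elim: y {ds0 W} => //= -[].
have W2 := @walk_right _ _ B uhalt udelta Hlt2 is_bitu l _ (map Dt (d :: ds)) isT _ bu.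
apply: reach_trans (W2 _) _; first by case=> // -[].
have -> : l = X :: rev (map uop ops ++ nseq m X) ++ uop HLT :: lprog pre.
  by rewrite /l /s -[in nseq m.+1 X]addn1 nseqD catA rev_cat.
have um : all nonX (rev (map Dt (map bit y))).
  by rewrite all_rev; elim: y {ds0 W W2 bu}.
have T := @turn_left _ _ B uhalt udelta Hlt2 Hlt3 nonX
   (rev (map uop ops ++ nseq m X) ++ uop HLT :: lprog pre) X _ (map Dt (d :: ds))
   (if d is DK then Dt DK else B) isT isT _ _ um.
apply: reach_trans (T _ _) _; [by case: d nb {ds0 W W2 T} | by case |].
apply: step_reach; first by [].
rewrite revK; exact: reach_refl.
Qed.

Lemma reach_neq (Q G : Type) (bl : G) hlt dlt (c c' : sconf Q G) :
  reach bl hlt dlt c c' -> c.1.2 <> c'.1.2 -> reach1 bl hlt dlt c c'.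
Proof. by case=> -[|n] E ne; [case: ne; rewrite -E | exists n]. Qed.

(** * Turing machines as queue automata *)

Section Compile.
Variable M : TM.

(* Queue letters: 0, 1, 2 are the first three letters of [M], 3 separates the
   right end of the tape from its left end, [mark] is a rotation mark, and the
   other letters of [M] are shifted by one. *)
Definition sep := 3.
Definition qmark := tm_nsym M + 4.
Notation K := qmark.+1.
Definition qsym (a : tsym M) : nat := if (a : nat) < 3 then (a : nat) else (a : nat).+1.
Definition symq (i : nat) : tsym M := inord (if i < 3 then i else i.-1).

Lemma qsymK : cancel qsym symq.
Proof.
move=> a; rewrite /symq /qsym; case: (ltnP a 3) => h; first by rewrite h inord_val.
by rewrite ltnNge leqW // inord_val.
Qed.

Lemma qsym_lt a : qsym a < qmark.
Proof.
have : (a : nat) < tm_nsym M + 3 by rewrite addn3.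
rewrite /qsym /qmark addn3 addn4; case: ifP => _ h //.
exact: ltnW.
Qed.

Lemma qsym_neq_sep a : (qsym a == sep) = false.
Proof.
rewrite /qsym /sep; case: ifP => h; first by rewrite ltn_eqF.
by rewrite gtn_eqF // ltnS leqNgt h.
Qed.

Lemma sep_lt : sep < qmark. Proof. by rewrite /qmark addn4. Qed.

(* [Run q]: the scanned cell is at the front.  [Rot q]: rotate up to the mark,
   then run in state [q].  [Hold0 q], [Hold q c]: rotate with one letter held
   back, so that the letter before the mark (the left neighbour of the head)
   can be moved behind the mark. *)
Notation st := (tstate M).
Definition qstate : finType := (st + st + (st + st * 'I_K))%type.
Definition Run q : qstate := inl (inl q).
Definition Rot q : qstate := inl (inr q).
Definition Hold0 q : qstate := inr (inl q).
Definition Hold q c : qstate := inr (inr (q, inord c)).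

Definition run_or_halt q := if tm_halt M q then None else Some (Run q).

(** If the letter held back is the separator, the head was on the leftmost cell, and a new blank,
    letter 0, becomes its left neighbour. *)
Definition hold_end c := if c == sep then [:: sep; qmark; 0] else [:: qmark; c].

(** The queue is the tape read cyclically from the head. Appending the written letter thus already
    is a move to the right; to stay, a mark is put before that letter and the queue is rotated up to
    it. Reading [sep] means that the head has left the tape on the right, and a blank is inserted
    before the separator. *)
Definition qdelta (s : qstate) (i : nat) : seq nat * option qstate :=
  match s with
  | inl (inl q) =>
      if i == sep then ([:: qmark; 0; sep], Some (Rot q)) else
      let: (q', a', mv) := tm_delta M q (symq i) in
      match mv with
      | MoveR => ([:: qsym a'], run_or_halt q')
      | MoveS => ([:: qmark; qsym a'], Some (Rot q'))
      | MoveL => ([:: qmark; qsym a'], Some (Hold0 q'))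
      end
  | inl (inr q) =>
      if i == qmark then ([::], run_or_halt q) else ([:: i], Some (Rot q))
  | inr (inl q) => ([::], Some (Hold q i))
  | inr (inr (q, c)) =>
      if i == qmark then (hold_end c, Some (Rot q))
      else ([:: val c], Some (Hold q i))
  end.

(** There is no reflexive rule, so that a step of [M] costs at least one step of the universal
    machine. The side condition keeps the queue non-empty, as pushing ticks demands. *)
Inductive qreach : option qstate * seq nat -> option qstate * seq nat -> Prop :=
| qreach_step s i w nx Q : i <= qmark -> qdelta s i = (w, nx) -> Q ++ w <> [::] ->
    qreach (Some s, i :: Q) (nx, Q ++ w)
| qreach_trans x y z : qreach x y -> qreach y z -> qreach x z.

Lemma rot_reach q Q1 Q2 : all (fun i => i < qmark) Q1 -> Q1 ++ Q2 <> [::] ->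
  qreach (Some (Rot q), Q1 ++ qmark :: Q2) (run_or_halt q, Q2 ++ Q1).
Proof.
elim: Q1 Q2 => [|i Q1 IH] Q2 /=.
  move=> _ ne; have := @qreach_step (Rot q) qmark [::] (run_or_halt q) Q2.
  by rewrite cats0; apply=> //=; rewrite eqxx.
case/andP=> lt A _; rewrite -(cat_rcons i).
apply: qreach_trans (IH _ A _); last by case: (Q1) (Q2) => [|? ?] [].
have := @qreach_step (Rot q) i [:: i] (Some (Rot q)) (Q1 ++ qmark :: Q2).
rewrite -catA /= cats1; apply; [exact: ltnW | by rewrite /= ltn_eqF |].
by case: (Q1).
Qed.

Lemma hold_reach q c Q1 Q2 : c < qmark -> all (fun i => i < qmark) Q1 ->
  qreach (Some (Hold q c), Q1 ++ qmark :: Q2)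
         (Some (Rot q), Q2 ++ belast c Q1 ++ hold_end (last c Q1)).
Proof.
elim: Q1 c Q2 => [|i Q1 IH] c Q2 /= ltc.
  move=> _; apply: qreach_step => //=; first by rewrite eqxx inordK // ltnW.
  by rewrite /hold_end; case: ifP; case: (Q2).
case/andP=> lt A; rewrite -(cat_rcons c).
apply: (qreach_trans _ (IH i (rcons Q2 c) lt A)).
have := @qreach_step (Hold q c) i [:: c] (Some (Hold q i)) (Q1 ++ qmark :: Q2).
rewrite -catA /= cats1; apply; [exact: ltnW | | by case: (Q1)].
by rewrite /= ltn_eqF // inordK // ltnW.
Qed.

Definition queue l r := map qsym r ++ sep :: map qsym (rev l).

Lemma all_qsym s : all (fun i => i < qmark) (map qsym s).
Proof. by elim: s => //= a s ->; rewrite qsym_lt. Qed.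

Lemma all_queue l r : all (fun i => i < qmark) (queue l r).
Proof. by rewrite all_cat /= !all_qsym sep_lt. Qed.

Lemma queue_neq0 l r : queue l r <> [::].
Proof. by case: r. Qed.

Lemma sim_cons l q a r : ~~ tm_halt M q ->
  qreach (Some (Run q), queue l (a :: r))
    (let: (l', q', r') := mstep (l, q, a :: r) in (run_or_halt q', queue l' r')).
Proof.
move=> nh; rewrite /mstep /sstep (negbTE nh) /=.
have E : qdelta (Run q) (qsym a) = let: (q', a', mv) := tm_delta M q a in
      match mv with
      | MoveR => ([:: qsym a'], run_or_halt q')
      | MoveS => ([:: qmark; qsym a'], Some (Rot q'))
      | MoveL => ([:: qmark; qsym a'], Some (Hold0 q'))
      end by rewrite /= qsym_neq_sep qsymK.
have ne w : queue l r ++ w <> [::] by case: (r).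
move: E; case: (tm_delta M q a) => [[q' a'] []] E; last first.
- have := qreach_step (ltnW (qsym_lt a)) E (ne _).
  by rewrite [in X in _ -> X]/queue /= rev_cons map_rcons -cats1 -catA.
- apply: qreach_trans (qreach_step (ltnW (qsym_lt a)) E (ne _)) _.
  by apply: rot_reach; [exact: all_queue | case: (r)].
apply: qreach_trans (qreach_step (ltnW (qsym_lt a)) E (ne _)) _.
have [c [Q Ec]] : exists c Q, queue l r = c :: Q.
  by case: (queue l r) (@queue_neq0 l r) => // c Q; exists c, Q.
have := all_queue l r; rewrite Ec /= => /andP [ltc AQ].
apply: (qreach_trans (y := (Some (Hold q' c), Q ++ [:: qmark; qsym a']))).
  have := @qreach_step (Hold0 q') c [::] (Some (Hold q' c)) (Q ++ [:: qmark; qsym a']).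
  by rewrite cats0; apply=> //; [exact: ltnW | case: (Q)].
apply: qreach_trans (hold_reach _ _ ltc AQ) _.
case: l Ec {E ne} => [|d l] Ec.
  have [Eb El] : belast c Q = map qsym r /\ last c Q = sep.
    by move: Ec; rewrite /queue /= cats1 [RHS]lastI => /rcons_inj E2; case: E2 => <- <-.
  rewrite Eb El /hold_end eqxx.
  have := @rot_reach q' (qsym a' :: map qsym r ++ [:: sep]) [:: 0].
  rewrite /queue /= -!catA /= => H; apply: H => //.
  by rewrite qsym_lt all_cat all_qsym /= sep_lt.
have [Eb El] : belast c Q = queue l r /\ last c Q = qsym d.
  move: Ec; rewrite /queue /= rev_cons map_rcons -rcons_cons -rcons_cat [RHS]lastI.
  by move=> /rcons_inj E2; case: E2 => <- <-.
rewrite Eb El /hold_end qsym_neq_sep.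
have := @rot_reach q' (qsym a' :: queue l r) [:: qsym d].
by apply=> //=; rewrite qsym_lt all_queue.
Qed.

Lemma sim_step l q r : ~~ tm_halt M q ->
  qreach (Some (Run q), queue l r)
    (let: (l', q', r') := mstep (l, q, r) in (run_or_halt q', queue l' r')).
Proof.
case: r => [|a r] nh; last exact: sim_cons.
have -> : mstep (l, q, [::]) = mstep (l, q, [:: blank M]) by rewrite /mstep /= (negbTE nh).
apply: (qreach_trans _ (sim_cons _ _ _ nh)).
have ne w : map qsym (rev l) ++ qmark :: w <> [::] by case: (rev l).
have E : qdelta (Run q) sep = ([:: qmark; 0; sep], Some (Rot q)) by [].
have ne' : map qsym (rev l) ++ [:: qmark; 0; sep] <> [::] by exact: ne.
apply: qreach_trans (qreach_step (ltnW sep_lt) E ne') _.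
have := @rot_reach q (map qsym (rev l)) [:: 0; sep] (all_qsym _).
by rewrite /run_or_halt (negbTE nh); apply; case: (rev l).
Qed.

(** * The transition table as a program *)

Definition qcode Q := flatten (map code Q).

Lemma code_neq0 i : code i <> [::]. Proof. by case: i => [|[|[|[|i]]]]. Qed.

Lemma qcode_neq0 Q : Q <> [::] -> qcode Q <> [::].
Proof. by case: Q => // i Q _; rewrite /qcode /=; case: (code i) (@code_neq0 i). Qed.

Lemma qcode_cat Q Q' : qcode (Q ++ Q') = qcode Q ++ qcode Q'.
Proof. by rewrite /qcode map_cat flatten_cat. Qed.

(** Each state owns a block of [K] consecutive entries. The ticks pushed for the state and the code
    of the front letter are consumed in one count, so the jump ends at the sum of the two numbers;
    the 1 skips the initial entry. *)
Definition qidx (s : qstate) := 1 + enum_rank s * K.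

Definition entry (x : seq nat * option qstate) : seq op :=
  map App (qcode x.1) ++
  (if x.2 is Some s then nseq (qidx s) PT else [:: HLT]).

Arguments qidx : simpl never.

(** Entry 0 is executed at the start: it closes the input with the separator. The others are ordered
    by state, then by letter. *)
Definition table : seq (seq op) :=
  entry ([:: sep], run_or_halt (tm_start M)) ::
  mkseq (fun i => entry (qdelta (nth (Rot ord0) (enum qstate) (i %/ K)) (i %% K)))
        (#|qstate| * K).

Arguments table : simpl never.

Lemma nonSEL_entry x : all nonSEL (entry x).
Proof.
rewrite all_cat; apply/andP; split; first by elim: (qcode _).
by case: x.2 => // s; rewrite all_nseq orbT.
Qed.

Lemma all_table : all (all nonSEL) table.
Proof.
apply/andP; split; first exact: nonSEL_entry.
change (all (all nonSEL) (mkseq (fun i => entry (qdelta (nth (Rot ord0) (enum qstate) (i %/ K)) (i %% K))) (#|qstate| * K))).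
by rewrite /mkseq all_map; apply/allP => i _; exact: nonSEL_entry.
Qed.

Lemma rank_lt (s : qstate) i : i <= qmark -> enum_rank s * K + i < #|qstate| * K.
Proof.
move=> le; apply: (@leq_trans ((enum_rank s).+1 * K)).
  by rewrite mulSn addnC ltn_add2r ltnS.
by rewrite leq_mul2r ltn_ord orbT.
Qed.

Lemma size_table : size table = (#|qstate| * K).+1.
Proof. by rewrite /table /= size_mkseq. Qed.

Lemma nth_table s i : i <= qmark ->
  nth [::] table (qidx s + i) = entry (qdelta s i).
Proof.
move=> le; rewrite /qidx /table /= nth_mkseq ?rank_lt //.
rewrite divnMDl // modnMDl divn_small ?ltnS // modn_small ?ltnS // addn0.
by rewrite nth_enum_rank.
Qed.

Definition room := size table.

(* The erased cells together with the ticks of the pending jump always leave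
   room to push the ticks of the next jump. *)
Definition urel (s : option qstate) (Q : seq nat) (u : sconf ustate usym) :=
  match s with
  | Some s => exists m, room <= m + qidx s /\
      u = uconf [::] Sel1 (prog table) m (nseq (qidx s) DK ++ qcode Q)
  | None => exists pre ops m, u = uconf pre Exec (HLT :: ops) m.+1 (qcode Q)
  end.

Lemma qidx_lt s : qidx s < room.
Proof. by have := @rank_lt s 0 (leq0n _); rewrite addn0 /room size_table ltnS. Qed.

Lemma exec_entry j m Q w nx : j < size table ->
  nth [::] table j = entry (w, nx) -> room <= m -> Q ++ w <> [::] ->
  exists u, ureach (at_entry table j Exec m (qcode Q)) u /\ urel nx (Q ++ w) u.
Proof.
move=> lt E le ne; rewrite /at_entry (prog_drop lt) E /entry -catA [_.1]/=.
case: nx E => [s|] E.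
  eexists; split; last first.
    exists (m - qidx s); split; last by reflexivity.
    by rewrite subnK // (leq_trans _ le) // ltnW ?qidx_lt.
  have := @exec_goto (prog (take j table)) (qcode w) (qidx s) (prog (drop j.+1 table))
    (m - qidx s) (qcode Q).
  rewrite -qcode_cat subnK; last by rewrite (leq_trans _ le) // ltnW ?qidx_lt.
  move=> H; move: (reach1W (H (qcode_neq0 ne))).
  have <- : prog (take j table) ++ prog (drop j table) = prog table.
    by rewrite -prog_cat cat_take_drop.
  by rewrite (prog_drop lt) E /entry /= -!catA.
case: m le => [|m] le; first by move: le; rewrite /room size_table.
exists (uconf (prog (take j table) ++ map App (qcode w)) Exec
  (HLT :: SEL :: prog (drop j.+1 table)) m.+1 (qcode (Q ++ w))).
split; last by do 3!eexists.
have := exec_Apps (prog (take j table)) (qcode w) (HLT :: SEL :: prog (drop j.+1 table)) m.+1 (qcode Q).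
by rewrite -qcode_cat.
Qed.

Lemma urel_step s i w nx Q u : i <= qmark -> qdelta s i = (w, nx) ->
  Q ++ w <> [::] -> urel (Some s) (i :: Q) u ->
  exists u', ureach1 u u' /\ urel nx (Q ++ w) u'.
Proof.
move=> le E ne [m [room_m ->]].
have lt : qidx s + i < size table.
  by rewrite size_table ltnS /qidx -addnA add1n rank_lt.
have lt0 : 0 < size table by rewrite size_table.
have lt1 : qidx s < size table by apply: leq_ltn_trans lt; rewrite leq_addr.
pose m' := m + qidx s + size (code i).
have E2 : nth [::] table (qidx s + i) = entry (w, nx) by rewrite nth_table // E.
have room_m' : room <= m' by apply: leq_trans room_m _; rewrite leq_addr.
have [u' [R U]] := exec_entry lt E2 room_m' ne.
exists u'; split=> //; apply: reach1_trans R; apply: reach_neq => //.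
have S0 : uconf [::] Sel1 (prog table) m (nseq (qidx s) DK ++ qcode (i :: Q)) =
    at_entry table 0 Sel1 m (nseq (qidx s) DK ++ code i ++ qcode Q).
  by rewrite /at_entry take0 drop0.
rewrite S0; apply: (reach_trans (@sel_ticks _ all_table 0 (qidx s) m _ lt1)).
rewrite add0n; exact: (@sel_code _ all_table).
Qed.

Lemma urel_reach x y : qreach x y -> forall u, urel x.1 x.2 u ->
  exists u', ureach1 u u' /\ urel y.1 y.2 u'.
Proof.
elim=> {x y} [s i w nx Q le E ne|x y z _ IH1 _ IH2] u; first exact: urel_step.
move=> /IH1 [u1 [R1 /IH2 [u2 [R2 U2]]]]; exists u2; split=> //.
by apply: reach1_trans R1 (reach1W R2).
Qed.

Definition mrel (c : sconf (tstate M) (tsym M)) u :=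
  let: (l, q, r) := c in urel (run_or_halt q) (queue l r) u.

Lemma mrel_step c u : ~~ tm_halt M c.1.2 -> mrel c u ->
  exists u', ureach1 u u' /\ mrel (mstep c) u'.
Proof.
case: c => [[l q] r] nh; rewrite {1}/mrel {1}/run_or_halt (negbTE nh) => U.
move: (sim_step l r nh); case: (mstep (l, q, r)) => [[l' q'] r'] R.
exact: (@urel_reach _ _ R u U).
Qed.

Lemma mrel_nonhalt c u : mrel c u -> ~~ uhalt u.1.2.
Proof.
case: c => [[l q] r] /=; case: (run_or_halt q) => [s|] /=.
  by case=> m [_ ->].
by case=> pre [ops [m ->]].
Qed.

Definition isB a := if a is B then true else false.
Definition before_blank (r : seq usym) := take (find isB r) r.

Lemma code_bool_inj : injective (code_bool M).
Proof. by case=> -[] //= /(congr1 val); rewrite /= !inordK. Qed.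

Lemma bits_prefix (r : seq (tsym M)) : exists y r',
  r = map (code_bool M) y ++ r' /\ forall b a r'', r' = a :: r'' -> a <> code_bool M b.
Proof.
elim: r => [|a r [y [r' [-> H]]]]; first by exists [::], [::].
case: (a =P code_bool M true) => [-> | n1]; first by exists (true :: y), r'.
case: (a =P code_bool M false) => [-> | n2]; first by exists (false :: y), r'.
exists [::], (a :: map (code_bool M) y ++ r'); split=> // b a' r'' [<- _].
by case: b.
Qed.

Lemma qsym_bit b : code (qsym (code_bool M b)) = [:: bit b].
Proof. by case: b; rewrite /qsym /code_bool inordK. Qed.

Lemma qcode_bits y : qcode (map qsym (map (code_bool M) y)) = map bit y.
Proof. by elim: y => //= b y IH; rewrite /qcode /= qsym_bit -IH. Qed.

Lemma bits_inj y z : map (fun b => Dt (bit b)) y = map (fun b => Dt (bit b)) z -> y = z.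
Proof. by apply: inj_map => -[] []. Qed.

Lemma cat_code_bool_blank y r : find (pred1 (blank M)) (map (code_bool M) y ++ r) =
  size y + find (pred1 (blank M)) r.
Proof.
elim: y => //= b y ->; case: eqP => // /(congr1 val).
by case: b; rewrite /= inordK.
Qed.

Lemma find_isB_bits y r : find isB (map Dt (map bit y) ++ r) = size y + find isB r.
Proof. by elim: y => //= b y ->. Qed.

Lemma take_size_add (T S : Type) (f : S -> T) (y : seq S) (r : seq T) n :
  take (size y + n) (map f y ++ r) = map f y ++ take n r.
Proof. by elim: y => //= b y ->. Qed.

(** The right part of the tape is split into its longest prefix of bits and a rest. If the rest is
    empty or begins with a blank, both outputs are that prefix. Otherwise both contain something
    other than a bit, and neither side of the equivalence holds for any [z]. *)
Lemma mrel_halt c u : tm_halt M c.1.2 -> mrel c u ->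
  exists u', [/\ ureach u u', uhalt u'.1.2 &
    forall z, take (find (pred1 (blank M)) c.2) c.2 = map (code_bool M) z <->
      before_blank u'.2 = map (fun b => Dt (bit b)) z].
Proof.
case: c => [[l q] r] /= h; rewrite /run_or_halt h => -[pre [ops [m ->]]].
have [y [r' [-> nb]]] := bits_prefix r.
have [d [ds [Ed nd Hd]]] : exists d ds,
  [/\ qcode (queue l r') = d :: ds, ~~ is_bit d &
     (d = DK <-> r' <> [::] /\ head (blank M) r' <> blank M)].
  rewrite /queue; case: r' nb => [|a r''] nb.
    by exists DS; eexists; split; [reflexivity | | split=> // -[]].
  rewrite /= {1}/qcode /=; have [n1 n2] := (nb true _ _ erefl, nb false _ _ erefl).
  have {n1 n2} [n1 n2] : (a : nat) <> 1 /\ (a : nat) <> 2.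
    by split=> E; [case: n2 | case: n1]; apply: val_inj; rewrite /= inordK.
  have [E|ne0] := altP (a =P blank M).
    by rewrite E; exists D0; eexists; split; [reflexivity | | split=> // -[]].
  have a3 : 2 < a.
    have : (a : nat) <> 0 by move=> E; case/eqP: ne0; apply: val_inj.
    by case: (nat_of_ord a) n1 n2 => [|[|[|n]]].
  (* Letters above 2 are shifted past the separator, so their codes begin with a tick. *)
  have [k Ek] : exists k, qsym a = k.+4.
    by exists (a - 3); rewrite /qsym ltnNge a3 /= -[in LHS](subnK a3) addn3.
  exists DK; eexists; split; [by rewrite Ek | by [] |].
  by split=> // _; split=> //; apply/eqP.
have -> : qcode (queue l (map (code_bool M) y ++ r')) = map bit y ++ d :: ds.
  by rewrite /queue map_cat -catA qcode_cat qcode_bits -Ed.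
have [L R] := @exec_HLT pre ops m y d ds nd.
eexists; split; [exact: R | by [] |] => z.
rewrite /before_blank [_.2]/= cat_code_bool_blank find_isB_bits.
rewrite take_size_add -[size y](size_map bit) take_size_add -map_comp.
have inj1 := inj_map code_bool_inj.
case dK : (if d is DK then true else false).
  have Ed' : d = DK by case: (d) dK.
  move: Hd Ed'; case: (d) => // -[Hd _] _; have {Hd} [ne hb] := Hd erefl.
  case: r' nb ne hb {Ed R} => //= a r'' nb _ ab.
  rewrite (introF eqP ab) /=; split=> [E|E]; exfalso.
    elim: y z E => [|b y IH] [|c z] //= [].
      by move=> E; case: (nb c _ _ erefl E).
    by move=> _ /IH.
  by elim: y z E => [|b y IH] [|c z] //= []; [case: c | move=> _ /IH].
have -> : (if d is DK then Dt DK else B) = B by case: (d) dK.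
have -> : find (pred1 (blank M)) r' = 0.
  case: (r') Hd => //= a r'' Hd; case: eqP => // ab.
  by have Ed' : d = DK; [apply/Hd | move: dK; rewrite Ed'].
rewrite !take0 !cats0; split; first by move/inj1 => ->.
by move/bits_inj => ->.
Qed.

End Compile.

(** * The universal machine as a [TM] *)

Definition dsym_n d := match d with D0 => 0 | D1 => 1 | D2 => 2 | DK => 3 | DS => 4 end.
Definition op_n o := match o with App d => dsym_n d | PT => 5 | SEL => 6 | HLT => 7 end.
(** The numbers 0, 1, 2 are forced: they must be the blank and the two letters of [code_bool]. *)
Definition usym_n a := match a with
  | B => 0 | Dt D1 => 1 | Dt D2 => 2 | Dt D0 => 3 | Dt DK => 4 | Dt DS => 5
  | X => 6 | LE => 7 | Op o b => 8 + 2 * op_n o + b end.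
Definition usyms := [:: B; Dt D1; Dt D2; Dt D0; Dt DK; Dt DS; X; LE] ++
  flatten [seq [:: Op o false; Op o true] | o <-
    [:: App D0; App D1; App D2; App DK; App DS; PT; SEL; HLT]].
Definition ustate_n q := match q with
  | Exec => 0 | Appd d => (dsym_n d).+1 | Ret => 6 | Push => 7 | Push1 => 8
  | Sel0 => 9 | Sel1 => 10 | Sel2 => 11 | SelRet => 12 | Adv => 13 | SelGo => 14
  | Hlt1 => 15 | Hlt2 => 16 | Hlt3 => 17 | Halt => 18 end.
Definition ustates := [:: Exec; Appd D0; Appd D1; Appd D2; Appd DK; Appd DS; Ret;
  Push; Push1; Sel0; Sel1; Sel2; SelRet; Adv; SelGo; Hlt1; Hlt2; Hlt3; Halt].

Definition enca (a : usym) : 'I_24 := inord (usym_n a).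
Definition encq (q : ustate) : 'I_19 := inord (ustate_n q).
Definition deca (i : 'I_24) := nth B usyms i.
Definition decq (i : 'I_19) := nth Exec ustates i.

Lemma usym_lt a : usym_n a < 24.
Proof. by case: a => [|[]||| [[]|||] []]. Qed.

Lemma encaK : cancel enca deca.
Proof.
move=> a; rewrite /deca /enca inordK ?usym_lt //.
by case: a => [|[]||| [[]|||] []].
Qed.

Lemma encqK : cancel encq decq.
Proof. by move=> q; rewrite /decq /encq inordK; case: q => // -[]. Qed.

Definition UTM : TM := {|
  tm_nsym := 21;
  tm_nst := 18;
  tm_start := encq Exec;
  tm_halt := fun q => uhalt (decq q);
  tm_delta := fun q a =>
    let: (q', a', mv) := udelta (decq q) (deca a) in (encq q', enca a', mv) |}.

Definition encc (c : sconf ustate usym) : sconf (tstate UTM) (tsym UTM) :=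
  let: (l, q, r) := c in (map enca l, encq q, map enca r).

Notation ustep := (sstep B uhalt udelta).

Lemma enca_blank : enca B = blank UTM.
Proof. by apply: val_inj; rewrite /= inordK. Qed.

Lemma head_enca r : head (blank UTM) (map enca r) = enca (head B r).
Proof. by case: r => //=; rewrite -enca_blank. Qed.

Lemma behead_enca r : behead (map enca r) = map enca (behead r).
Proof. by case: r. Qed.

Lemma mstep_encc c : mstep (encc c) = encc (ustep c).
Proof.
case: c => [[l q] r]; rewrite /mstep /sstep /encc head_enca behead_enca.
rewrite /tm_halt /tm_delta /= encqK encaK; case: (uhalt q) => //.
case: (udelta q (head B r)) => [[q' a'] []] //.
by case: l => //=; rewrite -enca_blank.
Qed.

Lemma iter_mstep_encc n c : iter n (@mstep UTM) (encc c) = encc (iter n ustep c).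
Proof. by elim: n => //= n ->; rewrite mstep_encc. Qed.

Lemma code_bool_UTM b : code_bool UTM b = enca (Dt (bit b)).
Proof. by case: b. Qed.

Lemma output_encc r :
  take (find (pred1 (blank UTM)) (map enca r)) (map enca r) =
  map enca (before_blank r).
Proof.
rewrite map_take find_map (eq_find (a2 := isB)) // => a /=.
rewrite -val_eqE /= /enca inordK ?usym_lt //.
by case: a => [|[]||| [[]|||] []].
Qed.

Section Simulate.
Variable M : TM.

Definition program : seq usym := LE :: map uop (prog (table M)) ++ nseq (room M) X.

Definition ustart (x : seq bool) : sconf ustate usym :=
  ([::], Exec, program ++ map (fun b => Dt (bit b)) x).

Definition mstart (x : seq bool) : sconf (tstate M) (tsym M) :=
  ([::], tm_start M, map (code_bool M) x).

Lemma tm_init_UTM x :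
  @tm_init UTM (map enca program ++ map (code_bool UTM) x) = tword (encc (ustart x)).
Proof.
rewrite tm_init_tword /encc /ustart map_cat -map_comp; congr (tword (_, _, _ ++ _)).
by apply: eq_map => b; rewrite code_bool_UTM.
Qed.

Lemma mrel_start x : exists u, ureach (ustart x) u /\ mrel (mstart x) u.
Proof.
have lt0 : 0 < size (table M) by rewrite size_table.
have ne : map (@qsym M) (map (code_bool M) x) ++ [:: sep] <> [::] by case: (map _ _).
have [u [R U]] := @exec_entry M 0 (room M) _ _ _ lt0 erefl (leqnn _) ne.
(* The first step crosses [LE]; entry 0 is then executed without a jump. *)
exists u; split=> //; apply: step_reach R.
by rewrite /at_entry take0 drop0 qcode_bits /uconf -map_comp /= -catA.
Qed.

Lemma mrel_iter x n : exists u, ureach (ustart x) u /\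
  mrel (iter n (@mstep M) (mstart x)) u.
Proof.
elim: n => [|n [u [R U]]]; first exact: mrel_start.
have [h|nh] := boolP (tm_halt M (iter n (@mstep M) (mstart x)).1.2).
  exists u; split=> //=; suff -> : mstep (iter n (@mstep M) (mstart x)) =
    iter n (@mstep M) (mstart x) by [].
  exact: (@iter_halted _ _ _ _ _ 1).
have [u' [R' U']] := mrel_step nh U.
by exists u'; split=> //; apply: reach_trans R (reach1W R').
Qed.

(** Strong induction on [t]: a simulated step uses up at least one of the [t] steps. If it took more
    than [t] steps, it would end in the halted configuration, but configurations related to one of
    [M] are not halted. *)
Lemma uhalt_mhalt t c u : mrel c u -> uhalt (iter t ustep u).1.2 ->
  exists n, tm_halt M (iter n (@mstep M) c).1.2.
Proof.
elim/ltn_ind: t c u => t IH c u U H.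
have [h|nh] := boolP (tm_halt M c.1.2); first by exists 0.
have [u' [[k E] U']] := mrel_step nh U.
have [lt|le] := ltnP k t.
  have lt' : t - k.+1 < t by rewrite ltn_subrL /= (leq_ltn_trans _ lt).
  have H' : uhalt (iter (t - k.+1) ustep u').1.2.
    by rewrite -E -iterD subnK.
  have [n hn] := IH _ lt' _ _ U' H'.
  by exists n.+1; rewrite iterSr.
have : ~~ uhalt u'.1.2 by exact: mrel_nonhalt U'.
by rewrite -E -(subnK (leqW le)) iterD (iter_halted _ _ _ H) H.
Qed.

Lemma uhalt_unique t t' (u : sconf ustate usym) : uhalt (iter t ustep u).1.2 ->
  uhalt (iter t' ustep u).1.2 -> iter t ustep u = iter t' ustep u.
Proof.
wlog le : t t' / t <= t'.
  by move=> H h h'; case/orP: (leq_total t t') => le; [|symmetry]; apply: H.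
by move=> h _; rewrite -(subnK le) iterD [RHS]iter_halted.
Qed.

Lemma halts_UTM x n : tm_halt M (iter n (@mstep M) (mstart x)).1.2 ->
  exists t, uhalt (iter t ustep (ustart x)).1.2 /\
   forall z, let r := (iter n (@mstep M) (mstart x)).2 in
     take (find (pred1 (blank M)) r) r = map (code_bool M) z <->
     before_blank (iter t ustep (ustart x)).2 = map (fun b => Dt (bit b)) z.
Proof.
move=> h; have [u [R U]] := mrel_iter x n.
have [u' [R' h' O]] := mrel_halt h U.
by have [t E] := reach_trans R R'; exists t; rewrite E.
Qed.

Lemma UTM_halts x t : uhalt (iter t ustep (ustart x)).1.2 ->
  exists n, tm_halt M (iter n (@mstep M) (mstart x)).1.2.
Proof.
move=> h; have [u [[k E] U]] := mrel_start x.
apply: (@uhalt_mhalt t _ u U).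
by rewrite -E -iterD addnC iterD (iter_halted _ _ _ h).
Qed.

End Simulate.

Lemma bits_enca r z :
  map enca r = map (code_bool UTM) z <-> r = map (fun b => Dt (bit b)) z.
Proof.
have -> : map (code_bool UTM) z = map enca (map (fun b => Dt (bit b)) z).
  by rewrite -map_comp; apply: eq_map => b; rewrite code_bool_UTM.
by split=> [/(inj_map (can_inj encaK)) | ->].
Qed.

Lemma tm_output_conf (M : TM) (c : sconf (tstate M) (tsym M)) :
  tm_output (tword c) = take (find (pred1 (blank M)) c.2) c.2.
Proof. by case: c => [[l q] r]; rewrite tm_output_tword. Qed.

Lemma uhalt_encc c : tm_halted (tword (encc c)) = uhalt c.1.2.
Proof. by rewrite tm_halted_tword; case: c => [[l q] r] /=; rewrite encqK. Qed.

Lemma output_UTM c : tm_output (tword (encc c)) = map enca (before_blank c.2).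
Proof. by rewrite tm_output_conf; case: c => [[l q] r]; rewrite output_encc. Qed.

Theorem UTM_universal : universal_TM UTM.
Proof.
move=> M; exists (map enca (program M)) => x.
rewrite /tm_halts /tm_result tm_init_UTM tm_init_tword -/(mstart M x).
split=> [|y]; split.
- move=> [n]; rewrite iter_tm_step_tword tm_halted_tword => /halts_UTM [t [h _]].
  by exists t; rewrite iter_tm_step_tword iter_mstep_encc uhalt_encc.
- move=> [t]; rewrite iter_tm_step_tword iter_mstep_encc uhalt_encc => /UTM_halts [n h].
  by exists n; rewrite iter_tm_step_tword tm_halted_tword.
- move=> [n]; rewrite iter_tm_step_tword tm_halted_tword tm_output_conf.
  move=> [/halts_UTM [t [h O]] /O E]; exists t.
  by rewrite iter_tm_step_tword iter_mstep_encc uhalt_encc output_UTM bits_enca.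
- move=> [t]; rewrite iter_tm_step_tword iter_mstep_encc uhalt_encc output_UTM bits_enca.
  move=> [h]; have [n hn] := UTM_halts h; have [t' [h' O]] := halts_UTM hn.
  (* All halting times give the same configuration, so the given one may be exchanged for the one
     whose output was compared with that of [M]. *)
  rewrite (uhalt_unique h h') => /O E; exists n.
  by rewrite iter_tm_step_tword tm_halted_tword tm_output_conf.
Qed.

(** * Smooth functions *)

Section Smooth.
Local Open Scope R_scope.

Fixpoint Cn n (g : R -> R) : Prop :=
  match n with
  | 0%nat => True
  | S n => exists g', (forall x, derivable_pt_lim g x (g' x)) /\ Cn n g'
  end.

Definition smooth1 g := forall n, Cn n g.

Lemma CnS n g : Cn n.+1 g -> Cn n g.
Proof. by elim: n g => //= n IH g [g' [D C]]; exists g'; split=> //; apply: IH. Qed.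

Lemma Cn_const n c : Cn n (fun=> c).
Proof. by elim: n c => //= n IH c; exists (fun=> 0); split=> // x; exact: derivable_pt_lim_const. Qed.

Lemma Cn_id n : Cn n (fun x => x).
Proof.
by case: n => //= n; exists (fun=> 1); split; [exact: derivable_pt_lim_id | exact: Cn_const].
Qed.

Lemma Cn_add n f g : Cn n f -> Cn n g -> Cn n (fun x => f x + g x).
Proof.
elim: n f g => //= n IH f g [f' [Df Cf]] [g' [Dg Cg]].
exists (fun x => f' x + g' x); split; last exact: IH.
by move=> x; exact: derivable_pt_lim_plus.
Qed.

Lemma Cn_mul n f g : Cn n f -> Cn n g -> Cn n (fun x => f x * g x).
Proof.
elim: n f g => //= n IH f g [f' [Df Cf]] [g' [Dg Cg]].
exists (fun x => f' x * g x + f x * g' x); split.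
  by move=> x; exact: derivable_pt_lim_mult.
have Cf1 : Cn n f by apply: CnS; exists f'.
have Cg1 : Cn n g by apply: CnS; exists g'.
by apply: Cn_add; apply: IH.
Qed.

Lemma Cn_affine n g a b : Cn n g -> Cn n (fun x => g (a * x + b)).
Proof.
elim: n g => //= n IH g [g' [D C]].
exists (fun x => g' (a * x + b) * a); split; last first.
  by apply: Cn_mul; [exact: IH | exact: Cn_const].
move=> x; apply: (derivable_pt_lim_comp (fun x => a * x + b) g); last exact: D.
rewrite -[X in derivable_pt_lim _ _ X](Rplus_0_r a) -[X in X + 0](Rmult_1_r a).
apply: derivable_pt_lim_plus; last exact: derivable_pt_lim_const.
by apply: derivable_pt_lim_scal; exact: derivable_pt_lim_id.
Qed.

Lemma Cn_inv n g : (forall x, 0 < g x) -> Cn n g -> Cn n (fun x => / g x).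
Proof.
move=> pos; elim: n => //= n IH [g' [D C]].
have Ci : Cn n (fun x => / g x) by apply/IH/CnS; exists g'.
exists (fun x => (-1 * g' x) * (/ g x * / g x)); split; last first.
  by do !apply: Cn_mul => //; exact: Cn_const.
move=> x; have nz : g x <> 0 by have := pos x; lra.
have := derivable_pt_lim_div (fct_cte 1) g x 0 (g' x) (derivable_pt_lim_const 1 x) (D x) nz.
have -> : (0 * g x - g' x * fct_cte 1 x) / Rsqr (g x) = -1 * g' x * (/ g x * / g x).
  by rewrite /fct_cte /Rsqr; field.
suff -> : (fct_cte 1 / g)%F = (fun x => / g x) by [].
by apply: functional_extensionality => y; rewrite /div_fct /fct_cte /Rdiv Rmult_1_l.
Qed.

(** The derivative of [phi m] is a linear combination of [phi m.+1] and [phi m.+2]; treating all [m]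
    together yields derivatives of every order for [phi 0], the usual flat function. *)
Definition phi m x := if Rle_dec x 0 then 0 else exp (- / x) * (/ x) ^ m.

Lemma exp_INR_mult n v : exp (INR n * v) = exp v ^ n.
Proof.
elim: n => [|n IH]; first by rewrite Rmult_0_l exp_0.
by rewrite S_INR Rmult_plus_distr_r Rmult_1_l exp_plus IH /= Rmult_comm.
Qed.

(** The [n]-th power of [u / n <= exp (u / n)]. *)
Lemma exp_ge_pow n u : 0 < u -> u ^ n <= INR n ^ n * exp u.
Proof.
case: n => [|n] u0; first by rewrite /= Rmult_1_l; have := exp_ineq1_le u; lra.
have n0 : 0 < INR n.+1 by apply: lt_0_INR; lia.
have -> : exp u = exp (u / INR n.+1) ^ n.+1.
  by rewrite -exp_INR_mult; congr exp; field; lra.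
rewrite -Rpow_mult_distr; apply: pow_incr; split; first lra.
have := exp_ineq1_le (u / INR n.+1) => H.
have : INR n.+1 * (1 + u / INR n.+1) <= INR n.+1 * exp (u / INR n.+1).
  by apply: Rmult_le_compat_l => //; lra.
have -> : INR n.+1 * (1 + u / INR n.+1) = INR n.+1 + u by field; lra.
lra.
Qed.

(** [exp_ge_pow] at [u = / x] with exponent [m + 2]. Being quadratic in [x], the bound makes each
    [phi m] differentiable at 0 with derivative 0. *)
Lemma phi_bound m x : 0 <= phi m x <= INR m.+2 ^ m.+2 * (x * x).
Proof.
have C0 : 0 <= INR m.+2 ^ m.+2 by apply: pow_le; exact: pos_INR.
rewrite /phi; case: (Rle_dec x 0) => [x0|x0] /=; first by split; [lra | apply: Rmult_le_pos => //; nra].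
have {}x0 : 0 < x by lra.
have u0 := Rinv_0_lt_compat _ x0; pose u := / x; rewrite -/u in u0 *.
have e0 := exp_pos (- u); have p0 := pow_lt _ m u0.
split; first by apply: Rmult_le_pos; lra.
have := exp_ge_pow m.+2 u0; set C := INR m.+2 ^ m.+2; rewrite -/C in C0 *.
move=> H; have Bd : exp (- u) * u ^ m.+2 <= C.
  apply: Rle_trans (Rmult_le_compat_l _ _ _ (Rlt_le _ _ e0) H) _.
  rewrite (Rmult_comm C) -Rmult_assoc -exp_plus Rplus_opp_l exp_0; lra.
have {}H := Rmult_le_compat_r (x * x) _ _ ltac:(nra) Bd.
suff <- : exp (- u) * u ^ m.+2 * (x * x) = exp (- u) * u ^ m by [].
rewrite /= /u; field; lra.
Qed.

Lemma derivable_phi m x :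
  derivable_pt_lim (phi m) x (- INR m * phi m.+1 x + phi m.+2 x).
Proof.
case: (Rtotal_order x 0) => [x0|[->|x0]].
- have -> : - INR m * phi m.+1 x + phi m.+2 x = 0.
    by rewrite /phi; case: (Rle_dec x 0) => /= *; lra.
  apply: (@derivable_pt_lim_locally_ext (fct_cte 0) _ _ (x - 1) 0); first lra.
    by move=> z z0; rewrite /phi; case: Rle_dec => /= *; rewrite /fct_cte; lra.
  exact: derivable_pt_lim_const.
- have E k : phi k 0 = 0 by rewrite /phi; case: Rle_dec => /= *; lra.
  rewrite !E => eps e0; set C := INR m.+2 ^ m.+2.
  have C0 : 0 <= C by apply: pow_le; exact: pos_INR.
  have d0 : 0 < eps / (C + 1) by apply: Rdiv_lt_0_compat; lra.
  exists (mkposreal _ d0) => h h0 /= hd.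
  rewrite Rplus_0_l E; have := phi_bound m h; rewrite -/C => B.
  have ah : 0 < Rabs h by exact: Rabs_pos_lt.
  have -> : (phi m h - 0) / h - (- INR m * 0 + 0) = phi m h / h by field.
  rewrite /Rdiv Rabs_mult Rabs_inv (Rabs_pos_eq _ (proj1 B)).
  apply: (Rmult_lt_reg_r (Rabs h)) => //.
  have -> : phi m h * / Rabs h * Rabs h = phi m h by field; lra.
  apply: Rle_lt_trans (proj2 B) _.
  have -> : h * h = Rabs h * Rabs h by rewrite -Rabs_mult Rabs_pos_eq //; nra.
  have : (C + 1) * Rabs h < eps.
    have -> : eps = (C + 1) * (eps / (C + 1)) by field; lra.
    by apply: Rmult_lt_compat_l => //; lra.
  nra.
pose g z := exp (- / z) * (/ z) ^ m.
apply: (@derivable_pt_lim_locally_ext g _ _ 0 (x + 1)); first lra.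
  by move=> z z0; rewrite /phi /g; case: Rle_dec => /= *; lra.
have nz : x <> 0 by lra.
have De : derivable_pt_lim exp (- / x) (exp (- / x)) by exact: derivable_pt_lim_exp.
have Di : derivable_pt_lim (fun z => / z) x (- / (x * x)).
  have := derivable_pt_lim_div (fct_cte 1) id x 0 1 (derivable_pt_lim_const 1 x) (derivable_pt_lim_id x) nz.
  have -> : (0 * id x - 1 * fct_cte 1 x) / Rsqr (id x) = - / (x * x).
    by rewrite /fct_cte /Rsqr /id; field.
  suff -> : (fct_cte 1 / id)%F = (fun z => / z) by [].
  by apply: functional_extensionality => y; rewrite /div_fct /fct_cte /Rdiv Rmult_1_l.
have D1 : derivable_pt_lim (fun z => exp (- / z)) x (exp (- / x) * - - / (x * x)).
  by apply: (derivable_pt_lim_comp (fun z => - / z) exp) => //; exact: derivable_pt_lim_opp.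
have D2 : derivable_pt_lim (fun z => (/ z) ^ m) x (INR m * (/ x) ^ m.-1 * - / (x * x)).
  by apply: (derivable_pt_lim_comp (fun z => / z) (fun z => z ^ m)) => //; exact: derivable_pt_lim_pow.
have := derivable_pt_lim_mult _ _ _ _ _ D1 D2.
suff -> : exp (- / x) * - - / (x * x) * (/ x) ^ m + exp (- / x) * (INR m * (/ x) ^ m.-1 * - / (x * x)) =
  - INR m * phi m.+1 x + phi m.+2 x by [].
rewrite /phi; case: (Rle_dec x 0) => [x1|x1]; first lra.
case: (m) => [|k] /=; first by field.
by field.
Qed.

Lemma Cn_phi n m : Cn n (phi m).
Proof.
elim: n m => //= n IH m; exists (fun x => - INR m * phi m.+1 x + phi m.+2 x).
split; first exact: derivable_phi.
by apply: Cn_add; [apply: Cn_mul; [exact: Cn_const|] |]; exact: IH.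
Qed.

Lemma phi0_pos x : 0 < x -> 0 < phi 0 x.
Proof. by move=> x0; rewrite /phi /=; case: Rle_dec => [x1|x1]; [lra | rewrite Rmult_1_r; exact: exp_pos]. Qed.

Lemma phi0_neg x : x <= 0 -> phi 0 x = 0.
Proof. by move=> x0; rewrite /phi; case: Rle_dec. Qed.

Definition sstp x := phi 0 x * / (phi 0 x + phi 0 (-1 * x + 1)).

Lemma sstp_den x : 0 < phi 0 x + phi 0 (-1 * x + 1).
Proof.
have [x0|x0] := Rle_dec x 0.
  have := phi_bound 0 x; have := @phi0_pos (-1 * x + 1); lra.
have := phi_bound 0 (-1 * x + 1); have := @phi0_pos x; lra.
Qed.

Lemma Cn_sstp n : Cn n sstp.
Proof.
apply: Cn_mul; first exact: Cn_phi.
apply: Cn_inv; first exact: sstp_den.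
by apply: Cn_add; [|apply: Cn_affine]; exact: Cn_phi.
Qed.

Lemma sstp0 x : x <= 0 -> sstp x = 0.
Proof. by move=> x0; rewrite /sstp phi0_neg // Rmult_0_l. Qed.

Lemma sstp1 x : 1 <= x -> sstp x = 1.
Proof.
move=> x1; rewrite /sstp [phi 0 (_ + 1)]phi0_neg; last lra.
by rewrite Rplus_0_r Rinv_r //; have := @phi0_pos x; lra.
Qed.

Lemma sstp_bound x : 0 <= sstp x <= 1.
Proof.
have D := sstp_den x; have [p _] := phi_bound 0 x.
have [p' _] := phi_bound 0 (-1 * x + 1).
have I := Rinv_0_lt_compat _ D; split; first by apply: Rmult_le_pos; lra.
apply: (Rmult_le_reg_r _ _ _ D); rewrite /sstp Rmult_assoc Rinv_l; lra.
Qed.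

(** The radius 1/4 is the tolerance with which digits of valid codes are known; vanishing from 1/2
    on makes plateaus around distinct integers non-zero on disjoint sets. *)
Definition plateau x := sstp (-4 * x + 2) * sstp (4 * x + 2).

Lemma smooth_plateau : smooth1 plateau.
Proof. by move=> n; apply: Cn_mul; apply: Cn_affine; exact: Cn_sstp. Qed.

Lemma plateau1 x : Rabs x <= 1/4 -> plateau x = 1.
Proof.
have h1 := Rle_abs x; have := Rle_abs (- x); rewrite Rabs_Ropp => h2 h.
by rewrite /plateau !sstp1; lra.
Qed.

Lemma plateau0 x : 1/2 <= Rabs x -> plateau x = 0.
Proof.
rewrite /plateau /Rabs; case: Rcase_abs => _ h.
  by rewrite [X in _ * X]sstp0 ?Rmult_0_r //; lra.
by rewrite sstp0 ?Rmult_0_l //; lra.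
Qed.

Lemma plateau_bound x : 0 <= plateau x <= 1.
Proof.
have := sstp_bound (-4 * x + 2); have := sstp_bound (4 * x + 2).
rewrite /plateau; nra.
Qed.
(** Choosing the derivative as a total function lets iterated derivatives be indexed by their order
    alone, which gives the family that [smooth2] asks for. *)
Definition deriv (g : R -> R) x := epsilon (inhabits 0) (derivable_pt_lim g x).

Lemma deriv_eq g g' : (forall x, derivable_pt_lim g x (g' x)) -> deriv g = g'.
Proof.
move=> D; apply: functional_extensionality => x.
apply: (uniqueness_limite g x) => //; rewrite /deriv.
by apply: epsilon_spec; exists (g' x).
Qed.

Definition nderiv g n := iter n deriv g.

Lemma smooth1_deriv g : smooth1 g -> smooth1 (deriv g).
Proof. by move=> S n; have [g' [D C]] := S n.+1; rewrite (deriv_eq D). Qed.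

Lemma smooth1_nderiv g n : smooth1 g -> smooth1 (nderiv g n).
Proof. by move=> S; elim: n => //= n; exact: smooth1_deriv. Qed.

Lemma nderivS g n x : smooth1 g ->
  derivable_pt_lim (nderiv g n) x (nderiv g n.+1 x).
Proof.
move=> S; have [g' [D _]] := smooth1_nderiv n S 1%nat.
by rewrite /= (deriv_eq D).
Qed.

(* In a sum of products [u(x) v(y)], mixed partial derivatives act on the [u]
   and the [v] separately. *)
Definition tensor (s : seq ((R -> R) * (R -> R))) x y :=
  foldr (fun uv acc => uv.1 x * uv.2 y + acc) 0 s.

Definition smooth_list (s : seq ((R -> R) * (R -> R))) :=
  forall uv, List.In uv s -> smooth1 uv.1 /\ smooth1 uv.2.

Definition tderiv (s : seq ((R -> R) * (R -> R))) (w : seq bool) :=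
  [seq (nderiv uv.1 (count negb w), nderiv uv.2 (count id w)) | uv <- s].

Lemma derivable_continuous_pt_lim g x l : derivable_pt_lim g x l ->
  forall e, 0 < e -> exists d, 0 < d /\ forall x', Rabs (x' - x) < d -> Rabs (g x' - g x) < e.
Proof.
move=> D e e0; have /derivable_continuous_pt C : derivable_pt g x by exists l.
have [d [d0 H]] := C e e0; exists d; split=> // x' lt.
case: (Req_dec x x') => [->|ne]; first by rewrite Rminus_diag_eq // Rabs_R0.
by apply: H; split=> //; split.
Qed.

Lemma dist2_lt p q d : 0 < d -> dist2 p q < d ^ 2 ->
  Rabs (p.1 - q.1) < d /\ Rabs (p.2 - q.2) < d.
Proof.
rewrite /dist2 => d0 H.
have A t : t ^ 2 < d ^ 2 -> Rabs t < d.
  move=> lt; rewrite -(Rabs_pos_eq d); last lra.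
  by apply: Rsqr_lt_abs_0; rewrite /Rsqr; lra.
have := pow2_ge_0 (p.1 - q.1); have := pow2_ge_0 (p.2 - q.2).
by split; apply: A; lra.
Qed.

Lemma continuous2_tensor s x y : smooth_list s -> continuous2 (tensor s) x y.
Proof.
elim: s => [|[u v] s IH] S e e0 /=.
  by exists 1; split; [lra | move=> *; rewrite Rminus_diag_eq // Rabs_R0].
have [Su Sv] := S (u, v) (or_introl erefl).
have [d1 [d10 H1]] := IH (fun uv i => S uv (or_intror i)) (e / 2) ltac:(lra).
(* With both increments below [n <= 1], the product [u v] changes by at most
   [n (1 + |u x| + |v y|)], which is below [n k <= e / 2]. *)
pose k := Rabs (u x) + Rabs (v y) + 2.
have pu := Rabs_pos (u x); have pv := Rabs_pos (v y).
pose n := Rmin 1 (e / 2 / k).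
have n0 : 0 < n by apply: Rmin_pos; [lra | apply: Rdiv_lt_0_compat; rewrite /k; lra].
have [d2 [d20 H2]] := derivable_continuous_pt_lim (nderivS 0 x Su) n0.
have [d3 [d30 H3]] := derivable_continuous_pt_lim (nderivS 0 y Sv) n0.
exists (Rmin d1 (Rmin d2 d3)); split; first by do !apply: Rmin_pos.
move=> x' y' D.
have m1 := Rmin_l d1 (Rmin d2 d3); have m2 := Rmin_r d1 (Rmin d2 d3).
have m3 := Rmin_l d2 d3; have m4 := Rmin_r d2 d3.
have d0 : 0 < Rmin d1 (Rmin d2 d3) by do !apply: Rmin_pos.
have [/= Dx Dy] := dist2_lt d0 D.
have {}H1 : Rabs (tensor s x' y' - tensor s x y) < e / 2.
  have le : Rmin d1 (Rmin d2 d3) ^ 2 <= d1 ^ 2 by apply: (pow_incr _ _ 2); lra.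
  apply: H1; lra.
have {}H2 : Rabs (u x' - u x) < n by apply: H2; lra.
have {}H3 : Rabs (v y' - v y) < n by apply: H3; lra.
have -> : u x' * v y' + tensor s x' y' - (u x * v y + tensor s x y) =
  ((u x' - u x) * (v y' - v y) + (u x' - u x) * v y + u x * (v y' - v y)) +
  (tensor s x' y' - tensor s x y) by ring.
apply: Rle_lt_trans (Rabs_triang _ _) _.
suff : Rabs ((u x' - u x) * (v y' - v y) + (u x' - u x) * v y + u x * (v y' - v y)) <= e / 2 by lra.
apply: Rle_trans (Rabs_triang _ _) _.
apply: Rle_trans (Rplus_le_compat_r _ _ _ (Rabs_triang _ _)) _.
rewrite !Rabs_mult.
have n1 : n <= 1 by exact: Rmin_l.
have nk : n * k <= e / 2.
  have -> : e / 2 = e / 2 / k * k by field; rewrite /k; lra.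
  by apply: Rmult_le_compat_r; [rewrite /k; lra | exact: Rmin_r].
have p2 := Rabs_pos (u x' - u x); have p3 := Rabs_pos (v y' - v y).
rewrite /k in nk.
have b1 : Rabs (u x' - u x) * Rabs (v y' - v y) <= n * 1.
  by apply: Rmult_le_compat; lra.
have b2 : Rabs (u x' - u x) * Rabs (v y) <= n * Rabs (v y).
  by apply: Rmult_le_compat_r; lra.
have b3 : Rabs (u x) * Rabs (v y' - v y) <= Rabs (u x) * n.
  by apply: Rmult_le_compat_l; lra.
nra.
Qed.

Lemma smooth_list_tderiv s w : smooth_list s -> smooth_list (tderiv s w).
Proof.
elim: s => //= uv s IH S uv1 [<-|] /=; last by apply: IH => uv' i; apply: S; right.
by have [S1 S2] := S uv (or_introl erefl); split; exact: smooth1_nderiv.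
Qed.

Lemma smooth2_tensor s : smooth_list s -> smooth2 (tensor s).
Proof.
move=> S; exists (fun w => tensor (tderiv s w)); split.
  by congr tensor; rewrite /tderiv /=; elim: (s) => //= -[u v] s' ->.
move=> w x y; split; last split.
- elim: s S => [|[u v] s IH] S /=; first exact: derivable_pt_lim_const.
  apply: derivable_pt_lim_plus; last by apply: IH => uv i; apply: S; right.
  have [Su _] := S (u, v) (or_introl erefl).
  rewrite -[X in derivable_pt_lim _ _ X](Rplus_0_r) -[X in _ + X](Rmult_0_r (nderiv u (count negb w) x)).
  apply: (derivable_pt_lim_mult (nderiv u (count negb w)) (fun=> nderiv v (count id w) y)).
    by have := nderivS (count negb w) x Su.
  exact: derivable_pt_lim_const.
- elim: s S => [|[u v] s IH] S /=; first exact: derivable_pt_lim_const.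
  apply: derivable_pt_lim_plus; last by apply: IH => uv i; apply: S; right.
  have [_ Sv] := S (u, v) (or_introl erefl).
  by apply: derivable_pt_lim_scal; have := nderivS (count id w) y Sv.
by apply: continuous2_tensor; apply: smooth_list_tderiv.
Qed.

End Smooth.

(** * The dynamical system *)

Section Dynamics.
Variable U : TM.
Local Open Scope R_scope.

Notation T := (cell U).
Notation digit := (option T).

(** The digit 0 is kept for the end of a stack: the code 0 shows it as its next digit, so an empty
    stack is recognised like any letter. *)
Definition idx (o : digit) : nat := if o is Some c then (enum_rank c).+1 else 0%nat.
Definition ncell : nat := #|{: T}|.
Definition ix (o : digit) : R := INR (idx o).
(** Four times the number of digits. A number whose leading digit is read with error at most 1/2 is
    then at most 1/4 in absolute value, so the tail of a stack blurs the digit on top of it by at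
    most 1/4. *)
Definition W : R := 4 * (INR ncell + 1).

Lemma W_gt0 : 0 < W.
Proof. by rewrite /W; have := pos_INR ncell; lra. Qed.

Lemma ix_bound o : 0 <= ix o <= INR ncell.
Proof.
rewrite /ix; split; first exact: pos_INR.
apply: le_INR; case: o => [c|] /=; last lia.
by apply/leP; exact: ltn_ord.
Qed.

Lemma idx_inj : injective idx.
Proof.
move=> [c|] [c'|] //= [E]; congr Some; apply: enum_rank_inj; exact: val_inj.
Qed.

Lemma ix_sep o o' t : Rabs (t - ix o) < 1/2 -> Rabs (t - ix o') < 1/2 -> o = o'.
Proof.
move=> h h'; apply: idx_inj; apply: INR_eq.
have L : Rabs (ix o - ix o') < 1.
  have -> : ix o - ix o' = (t - ix o') - (t - ix o) by ring.
  by apply: Rle_lt_trans (Rabs_triang _ _) _; rewrite Rabs_Ropp; lra.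
have C n m : (n < m)%coq_nat -> INR n + 1 <= INR m.
  by move=> lt; rewrite -S_INR; apply: le_INR; lia.
rewrite /ix in L.
case: (Nat.lt_trichotomy (idx o) (idx o')) => [lt|[-> //|lt]].
  have := C _ _ lt; have := Rle_abs (- (INR (idx o) - INR (idx o'))).
  by rewrite Rabs_Ropp; lra.
by have := C _ _ lt; have := Rle_abs (INR (idx o) - INR (idx o')); lra.
Qed.

(* Popping all of [s] from [t] leaves the code 0 of the empty stack, up to the
   tolerance [1 / (4 W)]. *)
Fixpoint inI (s : seq T) (t : R) : Prop :=
  match s with
  | [::] => Rabs (W * t) <= 1/4
  | c :: s => inI s (W * t - ix (Some c))
  end.

Fixpoint stack (s : seq T) : R :=
  if s is c :: s then (ix (Some c) + stack s) / W else 0.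

Fixpoint radius (s : seq T) : R := if s is _ :: s then radius s / W else / 4 / W.

Lemma radius_gt0 s : 0 < radius s.
Proof.
have := W_gt0; elim: s => [|c s IH] /= w0; apply: Rdiv_lt_0_compat => //; last exact: IH.
lra.
Qed.

Lemma W_dist t u : Rabs (W * t - W * u) = W * Rabs (t - u).
Proof. by rewrite -Rmult_minus_distr_l Rabs_mult (Rabs_pos_eq W) //; have := W_gt0; lra. Qed.

(** The recursive form of [inI] suits the dynamics, the metric form gives interiors and closures.
    They agree since popping is affine with slope [W]. *)
Lemma inI_ball s t : inI s t <-> Rabs (t - stack s) <= radius s.
Proof.
have w0 := W_gt0.
elim: s t => [|c s IH] t /=.
  have -> : W * t = W * t - W * 0 by ring.
  rewrite W_dist; split=> H.
    by apply: (Rmult_le_reg_l W) => //; have -> : W * (/ 4 / W) = 1/4 by field; lra.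
  have := Rmult_le_compat_l W _ _ (Rlt_le _ _ w0) H.
  by have -> : W * (/ 4 / W) = 1/4 by field; lra.
rewrite IH.
have -> : W * t - ix (Some c) - stack s = W * t - W * ((ix (Some c) + stack s) / W) by field; lra.
rewrite W_dist; split=> H.
  by apply: (Rmult_le_reg_l W) => //; have -> : W * (radius s / W) = radius s by field; lra.
have := Rmult_le_compat_l W _ _ (Rlt_le _ _ w0) H.
by have -> : W * (radius s / W) = radius s by field; lra.
Qed.

Lemma inI_stack s : inI s (stack s).
Proof.
by rewrite inI_ball Rminus_diag_eq // Rabs_R0; have := radius_gt0 s; lra.
Qed.

Lemma close_small o t : Rabs (W * t - ix o) <= 1/2 -> Rabs t <= 1/4.
Proof.
move=> H; have [i0 i1] := ix_bound o; have w0 := W_gt0.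
have h1 := Rle_abs (W * t - ix o); have h2 := Rle_abs (- (W * t - ix o)).
rewrite Rabs_Ropp in h2.
have B : Rabs (W * t - W * 0) <= W * (1/4).
  apply: Rabs_le; have : W * (1/4) = INR ncell + 1 by rewrite /W; field.
  lra.
rewrite W_dist Rminus_0_r in B; exact: (Rmult_le_reg_l W).
Qed.

Lemma inI_digit s t : inI s t -> Rabs (W * t - ix (ohead s)) <= 1/4.
Proof.
elim: s t => [|c s IH] t /=; first by rewrite /ix /= Rminus_0_r.
move/IH => H; apply: (@close_small (ohead s)); lra.
Qed.

Lemma inI_small s t : inI s t -> Rabs t <= 1/4.
Proof. by move/inI_digit => H; apply: (@close_small (ohead s)); lra. Qed.

Lemma inI_ohead s s' t : inI s t -> inI s' t -> ohead s = ohead s'.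
Proof. by move=> /inI_digit h /inI_digit h'; apply: (@ix_sep _ _ (W * t)); lra. Qed.

Lemma inI_uniq s s' t : inI s t -> inI s' t -> s = s'.
Proof.
elim: s s' t => [|c s IH] [|c' s'] t h h' //; have := inI_ohead h h' => // -[E].
by rewrite E in h *; congr cons; apply: IH h h'.
Qed.

Definition affine := (R * R)%type.
Definition aev (g : affine) x := g.1 * x + g.2.
Definition acomp (g h : affine) : affine := (g.1 * h.1, g.1 * h.2 + g.2).
Definition aid : affine := (1, 0).
Definition apop o : affine := (W, - ix o).
Definition apush o : affine := (/ W, ix o / W).
Definition areplace o o' : affine := (1, (ix o' - ix o) / W).

Lemma aev_comp g h x : aev (acomp g h) x = aev g (aev h x).
Proof. by rewrite /aev /acomp /=; ring. Qed.

Lemma aev_id x : aev aid x = x. Proof. by rewrite /aev /=; ring. Qed.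

Lemma aev_pop o x : aev (apop o) x = W * x - ix o.
Proof. by rewrite /aev /=; ring. Qed.

Lemma pop_push o x : W * aev (apush o) x - ix o = x.
Proof. by rewrite /aev /=; have := W_gt0 => w0; field; lra. Qed.

Lemma pop_replace o o' x : W * aev (areplace o o') x - ix o' = W * x - ix o.
Proof. by rewrite /aev /=; have := W_gt0 => w0; field; lra. Qed.

Lemma inI_push c s t : inI s t -> inI (c :: s) (aev (apush (Some c)) t).
Proof. by rewrite /= pop_push. Qed.

Lemma inI_replace c c' s t : inI (c :: s) t ->
  inI (c' :: s) (aev (areplace (Some c) (Some c')) t).
Proof. by rewrite /= pop_replace. Qed.

(* First letter of the left stack, first and second letter of the right one. *)
Definition key : finType := (digit * digit * digit)%type.

(** At the right end of the tape, a move to the right overwrites the old head cell by a blank one in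
    place: what lies below is the empty stack before and after. A right stack without a head cell on
    top belongs to no configuration; there the identity serves. *)
Definition branch (k : key) : affine * affine :=
  let: (dx, d1, d2) := k in
  match d1 with
  | Some (inr (q, a)) =>
    if tm_halt U q then (aid, aid) else
    let: (q', a', mv) := tm_delta U q a in
    match mv with
    | MoveS => (aid, areplace d1 (Some (inr (q', a'))))
    | MoveR => (apush (Some (inl a')),
        match d2 with
        | None => areplace d1 (Some (inr (q', blank U)))
        | Some c => acomp (areplace d2 (Some (mark q' c))) (apop d1)
        end)
    | MoveL =>
        let rest := acomp (apush (Some (inl a'))) (apop d1) in
        match dx with
        | None => (aid, acomp (apush (Some (inr (q', blank U)))) rest)
        | Some c => (apop dx, acomp (apush (Some (mark q' c))) rest)
        end
    end
  | _ => (aid, aid)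
  end.

Definition close e (k : key) (p : point) :=
  let: (dx, d1, d2) := k in
  Rabs (W * p.1 - ix dx) <= e /\ Rabs (W * p.2 - ix d1) <= e /\
  Rabs (W * (W * p.2 - ix d1) - ix d2) <= e.

Lemma push_small o t : Rabs t <= 1/2 -> Rabs (aev (apush o) t) <= 1/2.
Proof.
move=> h; suff : Rabs (aev (apush o) t) <= 1/4 by lra.
by apply: (@close_small o); rewrite pop_push.
Qed.

Lemma replace_small o o' t : Rabs (W * t - ix o) <= 1/2 ->
  Rabs (aev (areplace o o') t) <= 1/2.
Proof.
move=> h; suff : Rabs (aev (areplace o o') t) <= 1/4 by lra.
by apply: (@close_small o'); rewrite pop_replace.
Qed.

(** Stated for radius 1/2, that is wherever the plateaus may be non-zero, and not only on the
    rectangles: it confines the image of the whole disk. *)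
Lemma branch_small k p : close (1/2) k p ->
  Rabs (aev (branch k).1 p.1) <= 1/2 /\ Rabs (aev (branch k).2 p.2) <= 1/2.
Proof.
case: k => [[dx d1] d2] [hx [h1 h2]].
have sx : Rabs (aev aid p.1) <= 1/2 by rewrite aev_id; have := close_small hx; lra.
have sy : Rabs (aev aid p.2) <= 1/2 by rewrite aev_id; have := close_small h1; lra.
have p1 : Rabs (aev (apop d1) p.2) <= 1/2 by rewrite aev_pop.
rewrite /branch; case E1 : d1 => [[a|[q a]]|] //; rewrite -E1.
case: (tm_halt U q) => //; case: (tm_delta U q a) => [[q' a'] []] /=.
- by case: dx hx => [c|] hx /=; rewrite !aev_comp ?aev_pop; split=> //; do !apply: push_small; rewrite -?aev_pop.
- by split=> //; exact: replace_small.
split; first by apply: push_small; rewrite -(aev_id p.1).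
case: d2 h2 => [c|] h2; last exact: replace_small.
by rewrite aev_comp; apply: replace_small; rewrite aev_pop.
Qed.

Definition chi (k : key) x y :=
  plateau (W * x - ix k.1.1) *
  (plateau (W * y - ix k.1.2) * plateau (W * (W * y - ix k.1.2) - ix k.2)).

Lemma chi1 k p : close (1/4) k p -> chi k p.1 p.2 = 1.
Proof. by case: k => [[dx d1] d2] [hx [h1 h2]]; rewrite /chi !plateau1 //; ring. Qed.

Lemma chi_bound k x y : 0 <= chi k x y <= 1.
Proof.
rewrite /chi; have := plateau_bound (W * x - ix k.1.1); have := plateau_bound (W * y - ix k.1.2).
have := plateau_bound (W * (W * y - ix k.1.2) - ix k.2).
set a := plateau _; set b := plateau _; set c := plateau _ => Ha Hb Hc.
have bc : 0 <= b * a <= 1 by nra.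
nra.
Qed.

Lemma chi_neq0 k p : chi k p.1 p.2 <> 0 ->
  Rabs (W * p.1 - ix k.1.1) < 1/2 /\ Rabs (W * p.2 - ix k.1.2) < 1/2 /\
  Rabs (W * (W * p.2 - ix k.1.2) - ix k.2) < 1/2.
Proof.
rewrite /chi.
have b0 t : ~ Rabs t < 1/2 -> plateau t = 0 by move=> h; apply: plateau0; lra.
move=> nz; split; last split; apply: NNPP => h; apply: nz; rewrite (b0 _ h); ring.
Qed.

(** Windows of radius 1/2 around distinct digits are disjoint. The second digits of the right stack
    are compared last, since they are read after popping the first. *)
Lemma chi_uniq k k' p : chi k p.1 p.2 <> 0 -> chi k' p.1 p.2 <> 0 -> k = k'.
Proof.
case: k k' => [[dx d1] d2] [[dx' d1'] d2'].
move=> nz nz'; have /= [hx [h1 h2]] := chi_neq0 nz; have /= [hx' [h1' h2']] := chi_neq0 nz'.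
rewrite (ix_sep hx hx'); have E := ix_sep h1 h1'; rewrite E in h2 *.
by rewrite (ix_sep h2 h2').
Qed.

(** A term is [chi k] times an affine coordinate, its factors regrouped by variable and the
    arguments of [plateau] written as [a * x + b] for [Cn_affine]. *)
Definition f1_terms : seq ((R -> R) * (R -> R)) :=
  [seq (fun x => plateau (W * x + - ix k.1.1) * aev (branch k).1 x,
        fun y => plateau (W * y + - ix k.1.2) *
                 plateau (W * W * y + (- (W * ix k.1.2) - ix k.2))) | k : key].

Definition f2_terms : seq ((R -> R) * (R -> R)) :=
  [seq (fun x => plateau (W * x + - ix k.1.1),
        fun y => (plateau (W * y + - ix k.1.2) *
                  plateau (W * W * y + (- (W * ix k.1.2) - ix k.2))) *
                  aev (branch k).2 y) | k : key].

Definition disk_map (p : point) : point := (tensor f1_terms p.1 p.2, tensor f2_terms p.1 p.2).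

Lemma In_image (A : finType) (C : Type) (g : A -> C) y : List.In y [seq g k | k : A] ->
  exists k, y = g k.
Proof.
rewrite /image_mem; elim: (enum_mem _) => //= a s IH [<-|/IH //].
by exists a.
Qed.

Lemma Cn_aev n g : Cn n (aev g).
Proof. exact: (Cn_affine _ _ (Cn_id n)). Qed.

Lemma smooth_f1 : smooth2 (tensor f1_terms).
Proof.
apply: smooth2_tensor => uv H; have [k ->] := @In_image _ _ _ _ H; split=> n /=.
  by apply: Cn_mul (Cn_aev n _); apply: Cn_affine; exact: smooth_plateau.
by apply: Cn_mul; apply: Cn_affine; exact: smooth_plateau.
Qed.

Lemma smooth_f2 : smooth2 (tensor f2_terms).
Proof.
apply: smooth2_tensor => uv H; have [k ->] := @In_image _ _ _ _ H; split=> n /=.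
  by apply: Cn_affine; exact: smooth_plateau.
by apply: Cn_mul (Cn_aev n _); apply: Cn_mul; apply: Cn_affine; exact: smooth_plateau.
Qed.

Definition rsum (s : seq key) (g : key -> R) := foldr (fun k acc => g k + acc) 0 s.

Lemma tensor_rsum (u v : key -> R -> R) x y :
  tensor [seq (u k, v k) | k : key] x y = rsum (enum key) (fun k => u k x * v k y).
Proof. by rewrite /tensor /image_mem /rsum; elim: (enum _) => //= k s ->. Qed.

Lemma rsum_eq s g h : (forall k, g k = h k) -> rsum s g = rsum s h.
Proof. by move=> E; elim: s => //= k s ->; rewrite E. Qed.

Lemma rsum0 s g : (forall k, k \in s -> g k = 0) -> rsum s g = 0.
Proof.
elim: s => //= k s IH H; rewrite H ?inE ?eqxx // IH ?Rplus_0_l // => k' ks.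
by apply: H; rewrite inE ks orbT.
Qed.

Lemma rsum1 k0 g : (forall k, k <> k0 -> g k = 0) -> rsum (enum key) g = g k0.
Proof.
move=> H; have := enum_uniq key; have : k0 \in enum key by rewrite mem_enum.
elim: (enum _) => //= k s IH; rewrite inE => /orP [/eqP E|ks] /andP [ns us].
  rewrite -{}E in ns *; rewrite rsum0 ?Rplus_0_r // => k' ks; apply: H => E.
  by rewrite -E ks in ns.
rewrite IH // H ?Rplus_0_l // => E; by rewrite E ks in ns.
Qed.

Lemma disk_mapE p : disk_map p = (rsum (enum key) (fun k => chi k p.1 p.2 * aev (branch k).1 p.1),
                    rsum (enum key) (fun k => chi k p.1 p.2 * aev (branch k).2 p.2)).
Proof.
rewrite /disk_map /f1_terms /f2_terms !tensor_rsum; congr pair; apply: rsum_eq => k.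
  rewrite /chi /Rminus; have -> : W * W * p.2 + (- (W * ix k.1.2) + - ix k.2) =
    W * (W * p.2 + - ix k.1.2) + - ix k.2 by ring.
  ring.
rewrite /chi /Rminus; have -> : W * W * p.2 + (- (W * ix k.1.2) + - ix k.2) =
    W * (W * p.2 + - ix k.1.2) + - ix k.2 by ring.
ring.
Qed.

Lemma disk_map_branch k p : close (1/4) k p ->
  disk_map p = (aev (branch k).1 p.1, aev (branch k).2 p.2).
Proof.
move=> c; rewrite disk_mapE; have c1 := chi1 c.
by congr pair; rewrite (@rsum1 k) ?c1 ?Rmult_1_l // => k' ne;
  have -> : chi k' p.1 p.2 = 0; rewrite ?Rmult_0_l //;
  apply: NNPP => nz; case: ne; apply: (chi_uniq nz); rewrite c1; lra.
Qed.

(** At each point at most one term is non-zero, and it is a branch value of size at most 1/2 scaled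
    by a factor in [0, 1]. The image thus lies in a square inside the disk. *)
Lemma disk_map_disk p : in_disk (disk_map p).
Proof.
suff [h1 h2] : Rabs (disk_map p).1 <= 1/2 /\ Rabs (disk_map p).2 <= 1/2.
  rewrite /in_disk.
  have S t : Rabs t <= 1/2 -> t ^ 2 <= 1/4.
    by move=> h; rewrite -Rsqr_pow2 Rsqr_abs /Rsqr; have := Rabs_pos t; nra.
  by have := S _ h1; have := S _ h2; lra.
have [[k nz]|H] := classic (exists k, chi k p.1 p.2 <> 0); last first.
  have Z k : chi k p.1 p.2 = 0 by apply: NNPP => nz; apply: H; exists k.
  have E g : rsum (enum key) (fun k => chi k p.1 p.2 * g k) = 0.
    by apply: rsum0 => k _; rewrite Z Rmult_0_l.
  by rewrite disk_mapE /= !E Rabs_R0; lra.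
have c : close (1/2) k p.
  by have := chi_neq0 nz; case: (k) => [[dx d1] d2] /= [? [? ?]]; split; last split; lra.
have [s1 s2] := branch_small c; have [b0 b1] := chi_bound k p.1 p.2.
have Z k' : k' <> k -> chi k' p.1 p.2 = 0.
  by move=> ne; apply: NNPP => nz'; apply: ne; exact: chi_uniq nz' nz.
have M t : Rabs t <= 1/2 -> Rabs (chi k p.1 p.2 * t) <= 1/2.
  move=> h; rewrite Rabs_mult (Rabs_pos_eq _ b0); have := Rabs_pos t; nra.
by rewrite disk_mapE /=; split; rewrite (@rsum1 k); [exact: M | | exact: M |] => k' /Z ->;
  rewrite Rmult_0_l.
Qed.

Lemma smooth_disk_map_disk_map : smooth_disk_map disk_map.
Proof.
split; first by move=> p _; exact: disk_map_disk.
by exists (tensor f1_terms), (tensor f2_terms); split; [exact: smooth_f1|split; [exact: smooth_f2|]].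
Qed.

End Dynamics.

(** * Encoding and decoding *)

Section Coding.
Variable U : TM.
Local Open Scope R_scope.

Notation T := (cell U).

Definition lpart (w : seq T) := rev (take (find (@is_head U) w) w).
Definition rpart (w : seq T) := drop (find (@is_head U) w) w.

Lemma parts_cat w : rev (lpart w) ++ rpart w = w.
Proof. by rewrite /lpart revK cat_take_drop. Qed.

Lemma lpart_tword l q r : lpart (tword (l, q, r)) = map inl l.
Proof. by rewrite /lpart /tword find_tword take_tword map_rev revK. Qed.

Lemma rpart_tword l q r :
  rpart (tword (l, q, r)) = inr (q, head (blank U) r) :: map inl (behead r).
Proof. by rewrite /rpart /tword find_tword drop_tword. Qed.

Definition region w (p : point) :=
  wf_config w /\ inI (lpart w) p.1 /\ inI (rpart w) p.2.

Definition enc w : point := (stack (lpart w), stack (rpart w)).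

(** Defined by classical choice; its computability is shown afterwards by a machine that is compared
    with [region]. *)
Definition dec (p : point) : option (seq T) :=
  match excluded_middle_informative (exists w, region w p) with
  | left ex => Some (proj1_sig (constructive_indefinite_description _ ex))
  | right _ => None
  end.

Lemma region_uniq w w' p : region w p -> region w' p -> w = w'.
Proof.
move=> [_ [h1 h2]] [_ [h1' h2']].
by rewrite -(parts_cat w) -(parts_cat w') (inI_uniq h1 h1') (inI_uniq h2 h2').
Qed.

Lemma dec_Some p w : dec p = Some w <-> region w p.
Proof.
rewrite /dec; case: excluded_middle_informative => [ex|nex].
  case: constructive_indefinite_description => w' H /=; split=> [[<-] // | H'].
  by congr Some; exact: region_uniq H H'.
by split=> // H; case: nex; exists w.
Qed.

Lemma dec_None p : dec p = None <-> ~ exists w, region w p.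
Proof.
case E : (dec p) => [w|]; split=> //.
  by move=> H; case: H; exists w; apply/dec_Some.
by move=> _ [w /dec_Some]; rewrite E.
Qed.

Lemma region_enc w : wf_config w -> region w (enc w).
Proof. by move=> wf; split=> //; split; exact: inI_stack. Qed.

Lemma small_disk (p : point) : Rabs p.1 <= 1/2 -> Rabs p.2 <= 1/2 -> in_disk p.
Proof.
have S t : Rabs t <= 1/2 -> t ^ 2 <= 1/4.
  by move=> h; rewrite -Rsqr_pow2 Rsqr_abs /Rsqr; have := Rabs_pos t; nra.
by move=> /S h1 /S h2; rewrite /in_disk; lra.
Qed.

Lemma region_disk w p : region w p -> in_disk p.
Proof. by move=> [_ [/inI_small h1 /inI_small h2]]; apply: small_disk; lra. Qed.

Lemma region_tword l q r p : region (tword (l, q, r)) p <->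
  inI (map inl l : seq T) p.1 /\
  inI (inr (q, head (blank U) r) :: map inl (behead r) : seq T) p.2.
Proof.
rewrite /region lpart_tword rpart_tword; split=> [[_ //]|H].
by split=> //; exact: tword_wf.
Qed.

Lemma region_step w p : region w p -> region (tm_step w) (disk_map U p).
Proof.
move=> H; have [l [q [a [r E]]]] := wf_tword (proj1 H); rewrite {}E in H *.
move/region_tword: H => [hx hy]; rewrite [head _ _]/= [behead _]/= in hy; rewrite tm_step_tword.
have c : close (1/4) (ohead (map inl l : seq T), Some (inr (q, a)), ohead (map inl r : seq T)) p.
  split; first exact: inI_digit.
  split; last exact: (inI_digit (s := map inl r) hy).
  exact: (inI_digit (s := inr (q, a) :: map inl r) hy).
rewrite (disk_map_branch c) /mstep /sstep /branch.
case: (tm_halt U q); first by apply/region_tword; rewrite !aev_id.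
rewrite [head _ _]/=; case: (tm_delta U q a) => [[q' a'] mv].
(* Common to both left moves: the head cell gives way to the written letter before the new head cell
   is pushed. *)
have rest : inI (inl a' :: map inl r) (aev (acomp (apush (Some (inl a'))) (apop (Some (inr (q, a))))) p.2).
  by rewrite aev_comp; apply: inI_push; rewrite aev_pop.
case: mv.
- case: l hx {c} => [|c l] hx; apply/region_tword; rewrite /= aev_comp.
    by rewrite aev_id; split=> //; exact: (inI_push (inr (q', blank U)) rest).
  by rewrite aev_pop; split=> //; exact: (inI_push (inr (q', c)) rest).
- apply/region_tword; rewrite aev_id; split=> //.
  exact: (@inI_replace U (inr (q, a)) (inr (q', a')) _ _).
apply/region_tword; split; first exact: (inI_push (inl a') hx).
case: r hy {c rest} => [|c r] hy; first exact: (@inI_replace U (inr (q, a)) (inr (q', blank U)) _ _ hy).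
rewrite aev_comp; apply: (@inI_replace U (inl c) (inr (q', c)) _ _).
by rewrite aev_pop.
Qed.

Lemma closed_ball_seq a b r : (forall e, 0 < e -> exists c, Rabs (c - b) <= r /\ Rabs (a - c) < e) ->
  Rabs (a - b) <= r.
Proof.
move=> H; apply: Rnot_lt_le => lt; have [c [h1 h2]] := H (Rabs (a - b) - r) ltac:(lra).
have := Rabs_triang (a - c) (c - b); have -> : a - c + (c - b) = a - b by ring.
lra.
Qed.

Lemma open_region w p : wf_config w ->
  Rabs (p.1 - (enc w).1) < radius (lpart w) ->
  Rabs (p.2 - (enc w).2) < radius (rpart w) ->
  disk_interior (Cset dec w) p.
Proof.
move=> wf h1 h2.
have H q : Rabs (q.1 - (enc w).1) <= radius (lpart w) ->
    Rabs (q.2 - (enc w).2) <= radius (rpart w) -> Cset dec w q.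
  move=> q1 q2; have rq : region w q by split=> //; split; apply/inI_ball.
  by split; [exact: region_disk rq | apply/dec_Some].
split; first by apply: H; lra.
pose e1 := radius (lpart w) - Rabs (p.1 - (enc w).1).
pose e2 := radius (rpart w) - Rabs (p.2 - (enc w).2).
have e0 : 0 < Rmin e1 e2 by apply: Rmin_pos; rewrite /e1 /e2; lra.
exists (Rmin e1 e2); split=> // q _ /(dist2_lt e0) [d1 d2].
have m1 := Rmin_l e1 e2; have m2 := Rmin_r e1 e2.
rewrite /e1 in m1; rewrite /e2 in m2.
apply: H.
  have := Rabs_triang (q.1 - p.1) (p.1 - (enc w).1).
  have -> : q.1 - p.1 + (p.1 - (enc w).1) = q.1 - (enc w).1 by ring.
  rewrite (Rabs_minus_sym q.1 p.1) /e1 /e2 in m1 m2 d1 d2 *; lra.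
have := Rabs_triang (q.2 - p.2) (p.2 - (enc w).2).
have -> : q.2 - p.2 + (p.2 - (enc w).2) = q.2 - (enc w).2 by ring.
rewrite (Rabs_minus_sym q.2 p.2) /e1 /e2 in m1 m2 d1 d2 *; lra.
Qed.

Lemma enc_interior w : wf_config w -> disk_interior (Cset dec w) (enc w).
Proof.
move=> wf; apply: open_region; rewrite ?Rminus_diag_eq ?Rabs_R0 //; exact: radius_gt0.
Qed.

Lemma robust_enc_dec : robust_CDS enc dec.
Proof.
move=> w wf; split; last exact: enc_interior.
move=> p; split.
  move=> [pd /dec_Some [_ [/inI_ball h1 /inI_ball h2]]]; split=> // e e0.
  have M0 : 0 < 2 * (radius (lpart w) + radius (rpart w)).
    by have := radius_gt0 (lpart w); have := radius_gt0 (rpart w); lra.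
  (* A point of the closed rectangle is moved by the fraction [L] of its way to the centre [enc w]:
     the bound 1/2 keeps [1 - L] positive, the other one keeps the displacement below [e]. *)
  pose L := Rmin (1/2) (e / (2 * (radius (lpart w) + radius (rpart w)))).
  have L0 : 0 < L by apply: Rmin_pos; [lra | exact: Rdiv_lt_0_compat].
  have L1 : L <= 1/2 by exact: Rmin_l.
  have L2 : L * (2 * (radius (lpart w) + radius (rpart w))) <= e.
    have -> : e = e / (2 * (radius (lpart w) + radius (rpart w))) * (2 * (radius (lpart w) + radius (rpart w))) by field; lra.
    by apply: Rmult_le_compat_r; [lra | exact: Rmin_r].
  have r1 := radius_gt0 (lpart w); have r2 := radius_gt0 (rpart w).
  pose q : point := (p.1 - L * (p.1 - (enc w).1), p.2 - L * (p.2 - (enc w).2)).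
  have D1 : Rabs (p.1 - q.1) <= L * radius (lpart w).
    have -> : p.1 - q.1 = L * (p.1 - (enc w).1) by rewrite /=; ring.
    by rewrite Rabs_mult (Rabs_pos_eq L); [apply: Rmult_le_compat_l => //; lra | lra].
  have D2 : Rabs (p.2 - q.2) <= L * radius (rpart w).
    have -> : p.2 - q.2 = L * (p.2 - (enc w).2) by rewrite /=; ring.
    by rewrite Rabs_mult (Rabs_pos_eq L); [apply: Rmult_le_compat_l => //; lra | lra].
  exists q; split.
    apply: open_region => //.
      have -> : q.1 - (enc w).1 = (1 - L) * (p.1 - (enc w).1) by rewrite /=; ring.
      rewrite Rabs_mult (Rabs_pos_eq (1 - L)); [rewrite /= in h1 *; nra | lra].
    have -> : q.2 - (enc w).2 = (1 - L) * (p.2 - (enc w).2) by rewrite /=; ring.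
    rewrite Rabs_mult (Rabs_pos_eq (1 - L)); [rewrite /= in h2 *; nra | lra].
  have Sq t : t ^ 2 = Rabs t * Rabs t by rewrite -Rsqr_pow2 Rsqr_abs.
  rewrite /dist2 (Sq (p.1 - q.1)) (Sq (p.2 - q.2)).
  move: D1 D2; have := Rabs_pos (p.1 - q.1); have := Rabs_pos (p.2 - q.2).
  set a := Rabs _; set b := Rabs _ => a0 b0 D1 D2.
  have ab : a + b < e by nra.
  nra.
move=> [pd H]; split=> //; apply/dec_Some; split=> //.
split; apply/inI_ball; apply: closed_ball_seq => e e0.
  have [q [[[_ /dec_Some [_ [/inI_ball h _]]] _] d]] := H e e0.
  by have [d1 _] := dist2_lt e0 d; exists q.1.
have [q [[[_ /dec_Some [_ [_ /inI_ball h]]] _] d]] := H e e0.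
by have [_ d2] := dist2_lt e0 d; exists q.2.
Qed.

End Coding.

(** * Semialgebraic sets and machines with affine updates *)

Section Semialgebraic.
Local Open Scope R_scope.
Variable n : nat.
Implicit Types (P Q : ('I_n -> R) -> Prop) (F G : sa_formula n).

(** The list of machine constants is empty: integer coefficients suffice below, and the
    computability of the constants is then immediate. *)
Definition SA P := exists F, forall env, sa_holds [::] env F <-> P env.

Lemma SA_ext P Q : (forall env, P env <-> Q env) -> SA P -> SA Q.
Proof. by move=> E [F H]; exists F => env; rewrite H E. Qed.

Lemma conj_holds_cat env (c d : seq (sa_atom n)) :
  conj_holds [::] env (c ++ d) <-> conj_holds [::] env c /\ conj_holds [::] env d.
Proof. by elim: c => [|a c IH] /=; [tauto | rewrite IH; tauto]. Qed.

Lemma sa_holds_cat env F G :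
  sa_holds [::] env (F ++ G) <-> sa_holds [::] env F \/ sa_holds [::] env G.
Proof. by elim: F => [|a c IH] /=; [tauto | rewrite IH; tauto]. Qed.

Lemma SA_or P Q : SA P -> SA Q -> SA (fun env => P env \/ Q env).
Proof. by move=> [F HF] [G HG]; exists (F ++ G) => env; rewrite sa_holds_cat HF HG. Qed.

Lemma SA_and P Q : SA P -> SA Q -> SA (fun env => P env /\ Q env).
Proof.
move=> [F HF] [G HG]; exists [seq c ++ d | c <- F, d <- G] => env.
rewrite -HF -HG; elim: F {HF} => [|c F IH] /=; first tauto.
rewrite sa_holds_cat IH.
suff -> : sa_holds [::] env [seq c ++ d | d <- G] <->
  conj_holds [::] env c /\ sa_holds [::] env G by tauto.
by elim: G {HG IH} => [|d G IH] /=; [tauto | rewrite IH conj_holds_cat; tauto].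
Qed.

Lemma SA_True : SA (fun=> True).
Proof. by exists [:: [::]] => env /=; tauto. Qed.

Lemma SA_False : SA (fun=> False).
Proof. by exists [::]. Qed.

Lemma SA_Prop (A : Prop) : SA (fun=> A).
Proof.
by have [a|na] := classic A; [apply: SA_ext SA_True | apply: SA_ext SA_False]; tauto.
Qed.

Lemma SA_zero p : SA (fun env => peval [::] env p = 0).
Proof. by exists [:: [:: AZero p]] => env /=; tauto. Qed.

Lemma SA_pos p : SA (fun env => 0 < peval [::] env p).
Proof. by exists [:: [:: APos p]] => env /=; tauto. Qed.

Lemma SA_not P : SA P -> SA (fun env => ~ P env).
Proof.
move=> [F H]; apply: (@SA_ext (fun env => ~ sa_holds [::] env F)).
  by move=> env; rewrite H.
elim: F {H} => [|c F IH] /=; first by apply: SA_ext SA_True; tauto.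
apply: (@SA_ext (fun env => ~ conj_holds [::] env c /\ ~ sa_holds [::] env F)).
  by move=> env; tauto.
apply: SA_and IH; elim: c => [|a c IH] /=; first by apply: SA_ext SA_False; tauto.
apply: (@SA_ext (fun env => ~ atom_holds [::] env a \/ ~ conj_holds [::] env c)).
  by move=> env; have := classic (atom_holds [::] env a); tauto.
apply: SA_or IH; case: a => p /=.
  by apply: SA_ext (SA_or (SA_pos p) (SA_pos (PNeg p))) => env /=; lra.
by apply: SA_ext (SA_or (SA_zero p) (SA_pos (PNeg p))) => env /=; lra.
Qed.

Lemma SA_le p : SA (fun env => 0 <= peval [::] env p).
Proof. by apply: SA_ext (SA_or (SA_zero p) (SA_pos p)) => env; lra. Qed.

Lemma SA_exists (K : finType) (P : K -> ('I_n -> R) -> Prop) :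
  (forall k, SA (P k)) -> SA (fun env => exists k, P k env).
Proof.
move=> H; apply: (@SA_ext (fun env => exists2 k, k \in enum K & P k env)).
  by move=> env; split=> [[k _ h]|[k h]]; exists k; rewrite ?mem_enum.
elim: (enum K) => [|k s IH]; first by apply: SA_ext SA_False => env; split=> // -[].
apply: SA_ext (SA_or (H k) IH) => env; split=> [[h|[k' ks h]]|[k' + h]].
- by exists k => //; rewrite inE eqxx.
- by exists k' => //; rewrite inE ks orbT.
by rewrite inE => /orP [/eqP <-|ks]; [left | right; exists k'].
Qed.

Lemma SA_forall (K : finType) (P : K -> ('I_n -> R) -> Prop) :
  (forall k, SA (P k)) -> SA (fun env => forall k, P k env).
Proof.
move=> H; apply: (@SA_ext (fun env => ~ exists k, ~ P k env)).
  move=> env; split=> [h k|h [k]]; last exact.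
  by apply: NNPP => nk; apply: h; exists k.
by apply/SA_not/SA_exists => k; apply: SA_not.
Qed.

End Semialgebraic.

(** * Machines that use the real tape as three registers *)

Definition o30 : 'I_3 := @Ordinal 3 0 isT.
Definition o31 : 'I_3 := @Ordinal 3 1 isT.
Definition o32 : 'I_3 := @Ordinal 3 2 isT.

Lemma ord3 (P : 'I_3 -> Prop) : P o30 -> P o31 -> P o32 -> forall j, P j.
Proof.
move=> h0 h1 h2 [[|[|[|m]]] lt] //.
- by rewrite (_ : Ordinal lt = o30) //; apply: val_inj.
- by rewrite (_ : Ordinal lt = o31) //; apply: val_inj.
- by rewrite (_ : Ordinal lt = o32) //; apply: val_inj.
Qed.

Definition tri (x y z : R) (j : 'I_3) : R := nth 0%R [:: x; y; z] j.

(* [(i, (a, b, c))] stands for [(a * x_i + b) / c]. *)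
Definition lin := ('I_3 * (Z * Z * Z))%type.

Definition lev (u : lin) (x : 'I_3 -> R) : R :=
  let: (i, (a, b, c)) := u in ((IZR a * x i + IZR b) / IZR c)%R.

Section AffineMachine.
Local Open Scope R_scope.
Variables (A : Type) (nst : nat) (start : 'I_nst.+1) (hlt : pred 'I_nst.+1).
Variables (K : finType) (kap : ('I_3 -> R) -> K).
Variable act : 'I_nst.+1 -> A -> K -> ('I_nst.+1 * A * move) * (lin * lin * lin).

(** The real head never moves, and real values influence the control only through the finite
    classification [kap]. Semialgebraicity of the transitions thus reduces to that of the fibres of
    [kap]. *)
Definition mkHBSS : HBSS A := {|
  hb_nst := nst; hb_win := 3; hb_start := start; hb_halt := hlt; hb_consts := [::];
  hb_delta := fun q a x =>
    let: ((q', a', md), (u0, u1, u2)) := act q a (kap x) in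
    ((q', a', MoveS, md), tri (lev u0 x) (lev u1 x) (lev u2 x)) |}.

Definition nonzero_den (u : lin) := u.2.2 <> 0%Z.

Hypothesis kapP : forall N (g : 'I_3 -> 'I_N) k, SA (fun env => kap (fun j => env (g j)) = k).
Hypothesis actP : forall q a k, [/\ nonzero_den (act q a k).2.1.1,
  nonzero_den (act q a k).2.1.2 & nonzero_den (act q a k).2.2].

Lemma SA_lev N (g : 'I_3 -> 'I_N) h u : nonzero_den u ->
  SA (fun env => lev u (fun j => env (g j)) = env h).
Proof.
case: u => i [[a b] c] /= /not_0_IZR c0.
apply: SA_ext (SA_zero (PAdd (PAdd (PMul (PInt _ a) (PVar (g i))) (PInt _ b))
  (PNeg (PMul (PInt _ c) (PVar h))))) => env /=.
split=> [H|<-]; last by field.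
by apply: (Rmult_eq_reg_r (IZR c)) => //; field_simplify => //; lra.
Qed.

Lemma BSSC_mkHBSS : BSSC mkHBSS.
Proof.
split=> // q a o.
(* The graph is a finite union, over the values of [kap], of graphs of affine maps. *)
suff [F HF] : SA (fun env : 'I_(3 + 3) -> R => exists k, kap (fun j => env (lshift 3 j)) = k /\
   ((act q a k).1.1.1, (act q a k).1.1.2, MoveS, (act q a k).1.2) = o /\
   lev (act q a k).2.1.1 (fun j => env (lshift 3 j)) = env (rshift 3 o30) /\
   lev (act q a k).2.1.2 (fun j => env (lshift 3 j)) = env (rshift 3 o31) /\
   lev (act q a k).2.2 (fun j => env (lshift 3 j)) = env (rshift 3 o32)).
  exists F => x y; rewrite HF.
  have -> : (fun j => join_env x y (lshift 3 j)) = x.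
    by apply: functional_extensionality => j; rewrite /join_env -[lshift 3 j]/(unsplit (inl j)) unsplitK.
  have E j : join_env x y (rshift 3 j) = y j.
    by rewrite /join_env -[rshift 3 j]/(unsplit (inr j)) unsplitK.
  rewrite !E /hb_delta /=.
  case Ek : (act q a (kap x)) => [[[q' a'] md] [[u0 u1] u2]] /=.
  split=> [[H1 H2]|[k [Ekk]]].
    by exists (kap x); rewrite Ek /=; split=> //; split=> //; rewrite -!H2.
  rewrite -Ekk Ek /= => -[H1 [H2 [H3 H4]]]; split=> //.
  by apply: ord3; rewrite /tri /= ?H2 ?H3 ?H4.
apply: SA_exists => k; have [n0 n1 n2] := actP q a k.
apply: SA_and; first exact: kapP.
apply: SA_and; first exact: SA_Prop.
by apply: SA_and; [exact: SA_lev|apply: SA_and; exact: SA_lev].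
Qed.

Definition aconf := ('I_nst.+1 * ('I_3 -> R) * (Z -> A) * Z)%type.

Definition tset (dt : Z -> A) (dh : Z) (a : A) : Z -> A :=
  fun z => if (z =? dh)%Z then a else dt z.

Definition astep (c : aconf) : aconf :=
  let: (q, v, dt, dh) := c in
  if hlt q then c else
  let: ((q', a', md), (u0, u1, u2)) := act q (dt dh) (kap v) in
  (q', tri (lev u0 v) (lev u1 v) (lev u2 v), tset dt dh a', (dh + mv_z md)%Z).

Definition abs (c : hconf mkHBSS) : aconf :=
  let: (q, rt, rh, dt, dh) := c in (q, (fun j : 'I_3 => rt (rh + Z.of_nat j)%Z), dt, dh).

Lemma abs_step c : abs (hb_step c) = astep (abs c) /\ (hb_step c).1.1.2 = c.1.1.2.
Proof.
case: c => [[[[q rt] rh] dt] dh]; rewrite /hb_step /astep /abs /=.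
case: (hlt q) => //.
case: (act _ _ _) => [[[q' a'] md] [[u0 u1] u2]] /=; rewrite Z.add_0_r; split=> //.
congr (_, _, _, _); apply: functional_extensionality => j.
have -> : (rh <=? rh + Z.of_nat j)%Z = true by apply/Z.leb_le; lia.
have -> : Z.to_nat (rh + Z.of_nat j - rh) = j by rewrite Z.add_simpl_l Nat2Z.id.
by rewrite valK.
Qed.

Lemma abs_run t c : abs (hb_run t c) = iter t astep (abs c) /\
  (hb_run t c).1.1.2 = c.1.1.2.
Proof.
elim: t => //= t [IH1 IH2]; have [E1 E2] := abs_step (hb_run t c).
by rewrite E1 E2 IH1 IH2.
Qed.

Lemma hc_state_abs c : hc_state c = (abs c).1.1.1.
Proof. by case: c => [[[[q rt] rh] dt] dh]. Qed.

Lemma hc_dtape_abs c : hc_dtape c = (abs c).1.2.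
Proof. by case: c => [[[[q rt] rh] dt] dh]. Qed.

Lemma hc_rtape_abs c (j : 'I_3) : c.1.1.2 = 0%Z ->
  hc_rtape c (Z.of_nat j) = (abs c).1.1.2 j.
Proof. by case: c => [[[[q rt] rh] dt] dh] /= ->. Qed.

End AffineMachine.

Section HBSSFacts.
Variables (A : Type) (M : HBSS A).

Lemma hb_run_halted (c : hconf M) t : hb_halt M (hc_state c) -> hb_run t c = c.
Proof.
case: c => [[[[q rt] rh] dt] dh] h; elim: t => //= t.
by rewrite -/(hb_run t _) => ->; rewrite /hb_step; rewrite /hc_state /= in h; rewrite h.
Qed.

Lemma hb_runD (c : hconf M) s t : hb_run (s + t) c = hb_run s (hb_run t c).
Proof. exact: iterD. Qed.

(** Runs are followed for a convenient number of steps; the first halting time can only be smaller,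
    and the configuration is frozen from then on. *)
Lemma halts_at_le (c : hconf M) T : hb_halt M (hc_state (hb_run T c)) ->
  exists t, [/\ halts_at c t, t <= T & hb_run t c = hb_run T c].
Proof.
move=> h; have ex : exists t, hb_halt M (hc_state (hb_run t c)) by exists T.
case: (ex_minnP ex) => t ht min; have le := min _ h; exists t; split=> //.
  by split=> // t' lt; apply: contraTN lt => h'; rewrite -leqNgt; exact: min.
by rewrite -[in RHS](subnK le) hb_runD [RHS]hb_run_halted.
Qed.

Lemma halts_at_uniq (c : hconf M) t t' : halts_at c t -> halts_at c t' -> t = t'.
Proof.
move=> [h m] [h' m']; case: (ltngtP t t') => // lt.
  by have := m' _ lt; rewrite h.
by have := m _ lt; rewrite h'.
Qed.

End HBSSFacts.

(** * Linear-time encoder and decoder *)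

Arguments astep : simpl never.

Section Machines.
Variable U : TM.
Notation T := (cell U).
Notation digit := (option T).
Notation letter := (halpha U 0).

Definition keep i : lin := (i, (1, 0, 1)%Z).
Definition Wz : Z := (4 * (Z.of_nat (ncell U) + 1))%Z.
Definition lpush (o : digit) i : lin := (i, (1%Z, Z.of_nat (idx o), Wz)).
Definition lpop (o : digit) i : lin := (i, (Wz, (- Z.of_nat (idx o))%Z, 1%Z)).
Definition lone i : lin := (i, (0, 1, 1)%Z).

Lemma IZR_Wz : IZR Wz = W U.
Proof. by rewrite /Wz mult_IZR plus_IZR -INR_IZR_INZ. Qed.

Lemma lev_keep i v : lev (keep i) v = v i.
Proof. by rewrite /lev /=; lra. Qed.

Lemma lev_push o i v : lev (lpush o i) v = ((ix o + v i) / W U)%R.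
Proof. by rewrite /lev /lpush IZR_Wz -INR_IZR_INZ /ix Rmult_1_l Rplus_comm. Qed.

Lemma lev_pop o i v : lev (lpop o i) v = (W U * v i - ix o)%R.
Proof. by rewrite /lev /lpop IZR_Wz opp_IZR -INR_IZR_INZ /ix; field. Qed.

Lemma lev_one i v : lev (lone i) v = 1%R.
Proof. by rewrite /lev /=; lra. Qed.

Lemma Wz_neq0 : Wz <> 0%Z. Proof. by rewrite /Wz; lia. Qed.

Definition in_digit (t : R) (o : digit) : bool :=
  if Rle_dec (Rabs (W U * t - ix o)) (1/4) then true else false.

Lemma in_digitP t o : reflect (Rabs (W U * t - ix o) <= 1/4)%R (in_digit t o).
Proof. by rewrite /in_digit; case: Rle_dec => h; constructor. Qed.

(** [None] means that [t] lies in no window, [Some None] that the stack has ended. *)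
Definition dig (t : R) : option digit := [pick o | in_digit t o].

Lemma dig_Some t o : dig t = Some o <-> (Rabs (W U * t - ix o) <= 1/4)%R.
Proof.
rewrite /dig; case: pickP => [o' /in_digitP h'|h].
  split=> [[<-] //|h]; congr Some; apply: (@ix_sep _ _ _ (W U * t)); lra.
by split=> // /in_digitP; rewrite h.
Qed.

Lemma dig_inI s t : inI s t -> dig t = Some (ohead s).
Proof. by move/inI_digit/dig_Some. Qed.

Definition digs (v : 'I_3 -> R) : option digit * option digit * option digit :=
  (dig (v o30), dig (v o31), dig (v o32)).

Lemma SA_dig N (h : 'I_N) k : SA (fun env => dig (env h) = k).
Proof.
have S (o : digit) : SA (fun env : 'I_N -> R => (Rabs (W U * env h - ix o) <= 1/4)%R).
  pose t := PAdd (PMul (PInt N Wz) (PVar h)) (PInt N (- Z.of_nat (idx o))).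
  apply: (SA_ext _ (SA_and
    (SA_le (PAdd (PInt N 1) (PMul (PInt N 4) t)))
    (SA_le (PAdd (PInt N 1) (PMul (PInt N (-4)) t))))) => env /=.
  rewrite IZR_Wz opp_IZR -INR_IZR_INZ -/(ix o).
  split=> [[h1 h2]|H]; first by apply: Rabs_le; lra.
  have := Rle_abs (W U * env h - ix o); have := Rle_abs (- (W U * env h - ix o)).
  by rewrite Rabs_Ropp; lra.
case: k => [o|]; first by apply: (SA_ext _ (S o)) => env; rewrite dig_Some.
have Sn (o : digit) : SA (fun env : 'I_N -> R => ~ (Rabs (W U * env h - ix o) <= 1/4)%R).
  exact: SA_not (S o).
apply: SA_ext (SA_forall Sn) => env; split=> [H|E o /dig_Some]; last by rewrite E.
by case E : (dig (env h)) => [o|] //; case: (H o); apply/dig_Some.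
Qed.

Lemma SA_digs N (g : 'I_3 -> 'I_N) k : SA (fun env => digs (fun j => env (g j)) = k).
Proof.
case: k => [[k0 k1] k2].
apply: (SA_ext _ (SA_and (SA_dig (g o30) k0) (SA_and (SA_dig (g o31) k1) (SA_dig (g o32) k2)))).
by move=> env; rewrite /digs; split=> [[-> [-> ->]]|[-> -> ->]].
Qed.

Definition letter_of (c : T) : letter := Some (inl c).

Definition wtape (s : seq letter) : Z -> letter :=
  fun z => if (0 <=? z)%Z then nth None s (Z.to_nat z) else None.

Lemma wtape_nat s i : wtape s (Z.of_nat i) = nth None s i.
Proof. by rewrite /wtape Zle_imp_le_bool ?Nat2Z.id //; lia. Qed.

Lemma tset_id (dt : Z -> letter) dh : tset dt dh (dt dh) = dt.
Proof. by apply: functional_extensionality => z; rewrite /tset; case: Z.eqb_spec => // ->. Qed.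

Lemma tset_wtape s a b s' :
  tset (wtape (s ++ a :: s')) (Z.of_nat (size s)) b = wtape (s ++ b :: s').
Proof.
apply: functional_extensionality => z; rewrite /tset /wtape.
case: Z.leb_spec => z0; last by case: Z.eqb_spec => //; lia.
rewrite !nth_cat; case: Z.eqb_spec => [->|ne].
  by rewrite Nat2Z.id ltnn subnn.
case: ltnP => // le; case E : (Z.to_nat z - size s) => [|k] //.
by case: ne; move/leP: le => le; rewrite -(Z2Nat.id z) //; move: E; rewrite /subn /subn_rec /=; lia.
Qed.

Lemma wtape_rcons_None s : wtape (rcons s None) = wtape s.
Proof.
apply: functional_extensionality => z; rewrite /wtape; case: ifP => // _.
by rewrite nth_rcons; case: ltnP => // le; rewrite nth_default // if_same.
Qed.

Lemma wtape_Nones n : wtape (nseq n None) = fun=> None.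
Proof.
apply: functional_extensionality => z; rewrite /wtape nth_nseq.
by case: ifP => // _; case: ifP.
Qed.

Lemma tset_wtape_end s b : tset (wtape s) (Z.of_nat (size s)) b = wtape (rcons s b).
Proof. by rewrite -wtape_rcons_None -!cats1 tset_wtape. Qed.

(* Encoder: the left part of the word is pushed on the way to the right end of
   the word, the right part on the way back to the head. *)
Definition e0 : 'I_4 := @Ordinal 4 0 isT.
Definition e1 : 'I_4 := @Ordinal 4 1 isT.
Definition e2 : 'I_4 := @Ordinal 4 2 isT.
Definition e3 : 'I_4 := @Ordinal 4 3 isT.

Definition kept := (keep o30, keep o31, keep o32).

Definition eact (q : 'I_4) (a : letter) (k : unit) :
    ('I_4 * letter * move) * (lin * lin * lin) :=
  match val q, a with
  | 0, Some (inl (inl s)) => ((e0, a, MoveR), (lpush (Some (inl s)) o30, keep o31, keep o32))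
  | 0, Some (inl (inr _)) => ((e1, a, MoveR), kept)
  | 1, None => ((e2, a, MoveL), kept)
  | 1, _ => ((e1, a, MoveR), kept)
  | 2, Some (inl (inl s)) => ((e2, a, MoveL), (keep o30, lpush (Some (inl s)) o31, keep o32))
  | 2, Some (inl (inr h)) => ((e3, a, MoveS), (keep o30, lpush (Some (inr h)) o31, keep o32))
  | _, _ => ((e3, a, MoveS), kept)
  end.

Definition ehalt (q : 'I_4) := val q == 3.
Definition ekap (v : 'I_3 -> R) : unit := tt.
Definition EM : HBSS letter := mkHBSS e0 ehalt ekap eact.
Notation estep := (astep ehalt ekap eact).

Lemma EM_BSSC : BSSC EM.
Proof.
apply: BSSC_mkHBSS => [N g []|q a k]; first by apply: SA_ext (SA_True N).
have := Wz_neq0; rewrite /eact /nonzero_den.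
by case: (val q) => [|[|[|n]]]; case: a => [[[s|h]|a]|].
Qed.

Lemma astep_write nst (hlt : pred 'I_nst.+1) (K : finType) kap act q v dt dh a q' a' md u0 u1 u2 :
  hlt q = false -> dt dh = a ->
  act q a (kap v : K) = ((q', a', md), (u0, u1, u2)) ->
  astep (A := letter) hlt kap act (q, v, dt, dh) =
    (q', tri (lev u0 v) (lev u1 v) (lev u2 v), tset dt dh a', (dh + mv_z md)%Z).
Proof. by move=> h <- E; rewrite /astep h E. Qed.

Lemma astep_read nst (hlt : pred 'I_nst.+1) (K : finType) kap act q v dt dh a q' md u0 u1 u2 :
  hlt q = false -> dt dh = a ->
  act q a (kap v : K) = ((q', a, md), (u0, u1, u2)) ->
  astep (A := letter) hlt kap act (q, v, dt, dh) =
    (q', tri (lev u0 v) (lev u1 v) (lev u2 v), dt, (dh + mv_z md)%Z).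
Proof. by move=> h r E; rewrite (astep_write h r E) -r tset_id. Qed.

Notation eread q := (@astep_read 3 ehalt _ ekap eact q _ _ _ _ _ _ _ _ _ erefl).

Lemma tri_keep x y z :
  tri (lev (keep o30) (tri x y z)) (lev (keep o31) (tri x y z)) (lev (keep o32) (tri x y z)) = tri x y z.
Proof. by rewrite !lev_keep. Qed.

Lemma read_word (pre : seq T) c rest :
  wtape (map letter_of (pre ++ c :: rest)) (Z.of_nat (size pre)) = letter_of c.
Proof. by rewrite wtape_nat map_cat nth_cat size_map ltnn subnn. Qed.

Lemma read_end (w : seq T) : wtape (map letter_of w) (Z.of_nat (size w)) = None.
Proof. by rewrite wtape_nat nth_default ?size_map. Qed.

Lemma e_scan (pre : seq T) (l : seq (tsym U)) (rest s : seq T) y z :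
  let w := pre ++ map inl l ++ rest in
  iter (size l) estep (e0, tri (stack s) y z, wtape (map letter_of w), Z.of_nat (size pre)) =
  (e0, tri (stack (rev (map inl l) ++ s)) y z, wtape (map letter_of w),
   Z.of_nat (size pre + size l)).
Proof.
elim: l pre s => [|a l IH] pre s w; first by rewrite addn0.
have -> : w = pre ++ inl a :: (map inl l ++ rest) by [].
rewrite [size _]/= iterSr (eread e0 (read_word pre (inl a) _) erefl).
rewrite lev_push !lev_keep.
have := IH (rcons pre (inl a)) (inl a :: s); rewrite cat_rcons size_rcons addSnnS rev_cons cat_rcons.
by rewrite Nat2Z.inj_succ.
Qed.

Lemma e_skip (pre rest : seq T) x y z :
  let w := pre ++ rest in
  iter (size rest).+1 estep (e1, tri x y z, wtape (map letter_of w), Z.of_nat (size pre)) =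
  (e2, tri x y z, wtape (map letter_of w), (Z.of_nat (size pre + size rest) - 1)%Z).
Proof.
elim: rest pre => [|c rest IH] pre w.
  by rewrite /w cats0 /= (eread e1 (read_end _) erefl) tri_keep addn0.
have e1E : eact e1 (letter_of c) tt = ((e1, letter_of c, MoveR), kept) by [].
rewrite [size _]/= iterSr {}/w (eread e1 (read_word pre c _) e1E) tri_keep.
have := IH (rcons pre c); rewrite cat_rcons size_rcons addSnnS.
by rewrite Nat2Z.inj_succ.
Qed.

Lemma e_back (pre : seq T) h (r1 r2 : seq (tsym U)) x z :
  let w := pre ++ inr h :: map inl (r1 ++ r2) in
  iter (size r1).+1 estep (e2, tri x (stack (map inl r2 : seq T)) z, wtape (map letter_of w),
    Z.of_nat (size pre + size r1)) =
  (e3, tri x (stack (inr h :: map inl (r1 ++ r2) : seq T)) z, wtape (map letter_of w),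
    Z.of_nat (size pre)).
Proof.
elim/last_ind: r1 r2 => [|r1 a IH] r2 w.
  rewrite addn0 {}/w /= (eread e2 (read_word pre (inr h) _) erefl) lev_push !lev_keep.
  by rewrite Z.add_0_r.
rewrite size_rcons iterSr.
have E : w = (pre ++ inr h :: map inl r1) ++ inl a :: map inl r2.
  by rewrite /w cat_rcons -catA map_cat.
have R : wtape (map letter_of w) (Z.of_nat (size pre + (size r1).+1)) = letter_of (inl a).
  have := read_word (pre ++ inr h :: map inl r1) (inl a) (map inl r2).
  by rewrite -E size_cat /= size_map.
rewrite (eread e2 R erefl) lev_push !lev_keep.
have -> : (Z.of_nat (size pre + (size r1).+1) + mv_z MoveL)%Z = Z.of_nat (size pre + size r1).
  by rewrite /=; lia.
by have := IH (a :: r2); rewrite /w cat_rcons.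
Qed.

Lemma abs_init_word w : abs (init_word EM w) =
  (e0, tri 0 0 0, wtape (map letter_of w), 0%Z).
Proof.
rewrite /abs /init_word; congr (_, _, _, _).
by apply: functional_extensionality; apply: ord3.
Qed.

Lemma EM_run w : wf_config w -> exists2 t, t <= 2 * size w + 3 &
  exists dt dh, iter t estep (e0, tri 0 0 0, wtape (map letter_of w), 0%Z) =
    (e3, tri (enc w).1 (enc w).2 0, dt, dh).
Proof.
move=> wf; have [l [q [a [r ->]]]] := wf_tword wf.
(* From right to left: the scan of the left part, the head cell, the walk to the blank beyond the
   word, the way back to the head. *)
exists ((size r).+1 + ((size r).+1 + (1 + size l))).
  rewrite /tword size_cat /= !size_map size_rev; lia.
rewrite /enc lpart_tword rpart_tword [head _ _]/= [behead _]/=.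
rewrite /tword [head _ _]/= [behead _]/=; set w' := _ ++ _.
rewrite !iterD.
have := @e_scan [::] (rev l) (inr (q, a) :: map inl r) [::] 0 0.
rewrite size_rev /= cats0 -/w' add0n map_rev revK => ->.
have R : wtape (map letter_of w') (Z.of_nat (size l)) = letter_of (inr (q, a)).
  by have := read_word (map inl (rev l)) (inr (q, a)) (map inl r); rewrite size_map size_rev.
rewrite (eread e0 R erefl) tri_keep.
have := @e_skip (map inl (rev l) ++ [:: inr (q, a)]) (map inl r) (stack (map inl l : seq T)) 0 0.
rewrite -catA /= -/w' size_cat /= !size_map size_rev addn1 Nat2Z.inj_succ => ->.
have := @e_back (map inl (rev l)) (q, a) r [::] (stack (map inl l : seq T)) 0.
rewrite cats0 -/w' size_map size_rev.
have -> : (Z.of_nat ((size l).+1 + size r) - 1 = Z.of_nat (size l + size r))%Z by lia.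
by move=> /= ->; do 2!eexists.
Qed.

Lemma EM_computes : computes_E EM (@enc U) /\ time_E EM (fun n => 2 * n + 3).
Proof.
have H w : wf_config w -> exists t, [/\ halts_at (init_word EM w) t, t <= 2 * size w + 3 &
   (hc_rtape (hb_run t (init_word EM w)) 0%Z,
    hc_rtape (hb_run t (init_word EM w)) 1%Z) = enc w].
  move=> wf; have [T leT [dt [dh E]]] := EM_run wf.
  have [A Rh] := abs_run T (init_word EM w); rewrite abs_init_word E in A.
  have hT : hb_halt EM (hc_state (hb_run T (init_word EM w))) by rewrite hc_state_abs A.
  have [t [ht le Et]] := halts_at_le hT; exists t; split=> //; first exact: leq_trans le leT.
  have H0 := hc_rtape_abs o30 Rh; have H1 := hc_rtape_abs o31 Rh.
  rewrite A in H0 H1; rewrite Et [RHS]surjective_pairing.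
  by congr pair; [exact: H0 | exact: H1].
split=> w wf; first by have [t [h _ e]] := H w wf; exists t.
by move=> t ht; have [t' [h le _]] := H w wf; rewrite (halts_at_uniq ht h).
Qed.

End Machines.

Arguments letter_of {U} c.

Section Decoder.
Variable U : TM.
Notation T := (cell U).
Notation digit := (option T).
Notation letter := (halpha U 0).

(* Decoder.  [d1]: move right along the left stack, popped from a copy of its
   code, to find its length; [d2]: pop the left stack itself, writing on the
   way back; [d3]: return to the first blank cell; [d4]: pop the right stack.
   [d5] loops forever; in the final state the first real cell holds 1, so that
   the machine also computes the slowdown. *)
Definition d0 : 'I_7 := @Ordinal 7 0 isT.
Definition d1 : 'I_7 := @Ordinal 7 1 isT.
Definition d2 : 'I_7 := @Ordinal 7 2 isT.
Definition d3 : 'I_7 := @Ordinal 7 3 isT.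
Definition d4 : 'I_7 := @Ordinal 7 4 isT.
Definition d5 : 'I_7 := @Ordinal 7 5 isT.
Definition d6 : 'I_7 := @Ordinal 7 6 isT.

(** The top of the left stack is the last letter of the left part, hence its length must be known
    before anything is written. A code in no window and a letter out of place lead to [d5], which
    gives divergence off the domain. *)
Definition dact (q : 'I_7) (a : letter) (k : option digit * option digit * option digit) :
    ('I_7 * letter * move) * (lin * lin * lin) :=
  let: (kx, ky, kz) := k in
  match val q with
  | 0 => ((d1, a, MoveS), (keep o30, keep o31, keep o30))
  | 1 => match kz with
         | Some (Some (inl s)) => ((d1, a, MoveR), (keep o30, keep o31, lpop (Some (inl s)) o32))
         | Some None => ((d2, a, MoveL), kept)
         | _ => ((d5, a, MoveS), kept)
         end
  | 2 => match kx with
         | Some (Some (inl s)) =>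
             ((d2, letter_of (inl s), MoveL), (lpop (Some (inl s)) o30, keep o31, keep o32))
         | Some None => ((d3, a, MoveR), kept)
         | _ => ((d5, a, MoveS), kept)
         end
  | 3 => match a, ky with
         | Some _, _ => ((d3, a, MoveR), kept)
         | None, Some (Some (inr h)) =>
             ((d4, letter_of (inr h), MoveR), (keep o30, lpop (Some (inr h)) o31, keep o32))
         | _, _ => ((d5, a, MoveS), kept)
         end
  | 4 => match ky with
         | Some (Some (inl s)) =>
             ((d4, letter_of (inl s), MoveR), (keep o30, lpop (Some (inl s)) o31, keep o32))
         | Some None => ((d6, a, MoveS), (lone o30, keep o31, keep o32))
         | _ => ((d5, a, MoveS), kept)
         end
  | _ => ((d5, a, MoveS), kept)
  end.

Definition dhalt (q : 'I_7) := val q == 6.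
Definition DM : HBSS letter := mkHBSS d0 dhalt (@digs U) dact.
Notation dstep := (astep dhalt (@digs U) dact).

Lemma DM_BSSC : BSSC DM.
Proof.
apply: BSSC_mkHBSS => [N g k|q a [[kx ky] kz]]; first exact: SA_digs.
have := @Wz_neq0 U; rewrite /dact /nonzero_den.
case: (val q) => [|[|[|[|[|n]]]]] //; first by case: kz => [[[s|h]|]|].
- by case: kx => [[[s|h]|]|].
- by case: a => [a|] //; case: ky => [[[s|h]|]|].
by case: ky => [[[s|h]|]|].
Qed.

Lemma dread q x y z dt dh a q' md u0 u1 u2 : dhalt q = false -> dt dh = a ->
  dact q a (dig U x, dig U y, dig U z) = ((q', a, md), (u0, u1, u2)) ->
  dstep (q, tri x y z, dt, dh) =
    (q', tri (lev u0 (tri x y z)) (lev u1 (tri x y z)) (lev u2 (tri x y z)), dt, (dh + mv_z md)%Z).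
Proof. exact: astep_read. Qed.

Lemma dwrite q x y z dt dh a q' a' md u0 u1 u2 : dhalt q = false -> dt dh = a ->
  dact q a (dig U x, dig U y, dig U z) = ((q', a', md), (u0, u1, u2)) ->
  dstep (q, tri x y z, dt, dh) =
    (q', tri (lev u0 (tri x y z)) (lev u1 (tri x y z)) (lev u2 (tri x y z)), tset dt dh a', (dh + mv_z md)%Z).
Proof. exact: astep_write. Qed.

Notation syms := (map (@inl (tsym U) (tstate U * tsym U))).

Lemma d1_run l x y z dt dh : inI (syms l) z -> exists z',
  iter (size l).+1 dstep (d1, tri x y z, dt, dh) =
  (d2, tri x y z', dt, (dh + Z.of_nat (size l) - 1)%Z).
Proof.
elim: l z dh => [|s l IH] z dh I.
  exists z; rewrite /= (@dread d1 _ _ _ _ _ (dt dh) d2 MoveL (keep o30) (keep o31) (keep o32)) //.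
    by rewrite !lev_keep /=; congr (_, _, _, _); lia.
  by rewrite (dig_inI I).
have E := dig_inI I; rewrite [syms _]/= [ohead _]/= in E.
have [z' H] := IH _ (dh + 1)%Z I; exists z'.
rewrite [size _]/= iterSr (@dread d1 _ _ _ _ _ (dt dh) d1 MoveR (keep o30) (keep o31) (lpop (Some (inl s)) o32)) //; last by rewrite E.
by rewrite !lev_keep lev_pop H; congr (_, _, _, _); lia.
Qed.

Lemma d2_run l d x y z : inI (syms l) x -> exists x',
  iter (size l).+1 dstep (d2, tri x y z, wtape (nseq (size l) None ++ d), (Z.of_nat (size l) - 1)%Z) =
  (d3, tri x' y z, wtape (map letter_of (rev (syms l)) ++ d), 0%Z).
Proof.
elim: l d x => [|s l IH] d x I.
  (* After the last letter the head is on cell -1, which is blank, and steps back to 0. *)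
  exists x; rewrite /= (@dread d2 _ _ _ _ _ None d3 MoveR (keep o30) (keep o31) (keep o32)) //.
    by rewrite !lev_keep.
  by rewrite (dig_inI I).
have E := dig_inI I; rewrite [syms _]/= [ohead _]/= in E.
have [x' H] := IH (letter_of (inl s) :: d) _ I; exists x'.
rewrite [size _]/= iterSr; have -> : (Z.of_nat (size l).+1 - 1 = Z.of_nat (size (nseq (size l) (None : letter))))%Z.
  by rewrite size_nseq; lia.
have -> : nseq (size l).+1 None ++ d = nseq (size l) None ++ (None : letter) :: d.
  by elim: (size l) => //= n ->.
rewrite (@dwrite d2 _ _ _ _ _ _ d2 (letter_of (inl s)) MoveL (lpop (Some (inl s)) o30) (keep o31) (keep o32) erefl erefl); last by rewrite E.
rewrite tset_wtape size_nseq !lev_keep lev_pop; move: H => /= ->.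
by rewrite rev_cons map_rcons cat_rcons.
Qed.

Lemma d3_run (w w' : seq T) x y z :
  iter (size w') dstep (d3, tri x y z, wtape (map letter_of (w ++ w')), Z.of_nat (size w)) =
  (d3, tri x y z, wtape (map letter_of (w ++ w')), Z.of_nat (size w + size w')).
Proof.
elim: w' w => [|c w' IH] w; first by rewrite addn0.
rewrite [size _]/= iterSr (@dread d3 _ _ _ _ _ _ d3 MoveR (keep o30) (keep o31) (keep o32) erefl (read_word w c _)) //.
rewrite tri_keep; have := IH (rcons w c); rewrite cat_rcons size_rcons addSnnS.
by rewrite Nat2Z.inj_succ.
Qed.

Lemma d4_run r w x y z : inI (syms r) y -> exists y',
  iter (size r).+1 dstep (d4, tri x y z, wtape (map letter_of w), Z.of_nat (size w)) =
  (d6, tri 1 y' z, wtape (map letter_of (w ++ syms r)), Z.of_nat (size w + size r)).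
Proof.
elim: r w y => [|s r IH] w y I.
  exists y; rewrite /= (@dread d4 _ _ _ _ _ _ d6 MoveS (lone o30) (keep o31) (keep o32) erefl erefl).
    by rewrite !lev_keep lev_one cats0 addn0 Z.add_0_r.
  by rewrite (dig_inI I).
have E := dig_inI I; rewrite [syms _]/= [ohead _]/= in E.
have [y' H] := IH (rcons w (inl s)) _ I; exists y'.
rewrite [size _]/= iterSr (@dwrite d4 _ _ _ _ _ _ d4 (letter_of (inl s)) MoveR (keep o30) (lpop (Some (inl s)) o31) (keep o32) erefl erefl); last by rewrite E.
rewrite -[in tset _ _ _](size_map letter_of) tset_wtape_end !lev_keep lev_pop.
by move: H; rewrite map_rcons size_rcons cat_rcons addSnnS Nat2Z.inj_succ.
Qed.

Lemma d_left l p : inI (syms l) p.1 -> exists x' z',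
  iter (3 * size l + 3) dstep (d0, tri p.1 p.2 0, (fun=> None), 0%Z) =
  (d3, tri x' p.2 z', wtape (map letter_of (rev (syms l))), Z.of_nat (size l)).
Proof.
move=> I; have [z' H1] := @d1_run l p.1 p.2 p.1 (fun=> None) 0%Z I.
have [x' H2] := @d2_run l [::] p.1 p.2 z' I; exists x', z'.
have -> : 3 * size l + 3 = size l + ((size l).+1 + ((size l).+1 + 1)) by lia.
rewrite !iterD [iter 1 _ _]/= (@dread d0 _ _ _ _ _ None d1 MoveS (keep o30) (keep o31) (keep o30)) //.
rewrite !lev_keep [tri _ _ _ o30]/= [tri _ _ _ o31]/= H1 Z.add_0_l.
move: H2; rewrite !cats0 wtape_Nones => ->.
by have := @d3_run [::] (rev (syms l)) x' p.2 z'; rewrite size_rev size_map.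
Qed.

Lemma d_right w h r x y z : inI (inr h :: syms r) y -> exists y',
  iter (size r + 2) dstep (d3, tri x y z, wtape (map letter_of w), Z.of_nat (size w)) =
  (d6, tri 1 y' z, wtape (map letter_of (w ++ inr h :: syms r)), Z.of_nat (size w + (size r).+1)).
Proof.
move=> I; have E := dig_inI I; rewrite [ohead _]/= in E.
have [y' H] := @d4_run r (rcons w (inr h)) x _ z I; exists y'.
rewrite addn2 iterSr (@dwrite d3 _ _ _ _ _ _ d4 (letter_of (inr h)) MoveR (keep o30) (lpop (Some (inr h)) o31) (keep o32) erefl (read_end _)); last by rewrite E.
rewrite -[in tset _ _ _](size_map letter_of) tset_wtape_end !lev_keep lev_pop.
by move: H; rewrite map_rcons size_rcons cat_rcons addSnnS Nat2Z.inj_succ.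
Qed.

Lemma DM_run w p : region w p -> exists2 t, t <= 3 * size w + 6 & exists y z dh,
  iter t dstep (d0, tri p.1 p.2 0, (fun=> None), 0%Z) =
    (d6, tri 1 y z, wtape (map letter_of w), dh).
Proof.
move=> H; have [l [q [a [r E]]]] := wf_tword (proj1 H); rewrite {}E in H *.
move/region_tword: H => [hx hy]; rewrite [head _ _]/= [behead _]/= in hy.
have [x' [z' H1]] := d_left hx.
have [y' H2] := @d_right (rev (syms l)) (q, a) r x' p.2 z' hy.
exists ((size r + 2) + (3 * size l + 3)).
  rewrite /tword size_cat /= !size_map size_rev; lia.
rewrite iterD H1; rewrite size_rev size_map in H2; rewrite H2.
by do 3!eexists; rewrite /tword map_rev.
Qed.

Definition dhalts c := exists t, dhalt (iter t dstep c).1.1.1.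

Lemma dhalts_step c : dhalt c.1.1.1 = false -> dhalts c -> dhalts (dstep c).
Proof. by move=> h [[|t]] /=; [rewrite h | rewrite -iterS iterSr => H; exists t]. Qed.

Lemma dhalts_iter n c : dhalts c -> dhalts (iter n dstep c).
Proof.
elim: n => //= n IH /IH; move: (iter n dstep c) => [[[q v] dt] dh].
case E : (dhalt q); last exact: dhalts_step.
by move=> _; exists 0; rewrite /= /astep E /= E.
Qed.

Lemma d5_loop v dt dh : ~ dhalts (d5, v, dt, dh).
Proof.
case=> t; elim: t v dt dh => //= t IH v dt dh.
rewrite -iterS iterSr /astep [dhalt _]/= /dact.
by case: (digs U v) => [[kx ky] kz] /=; exact: IH.
Qed.

Lemma d1_halts x y z dt dh : dhalts (d1, tri x y z, dt, dh) -> exists l, inI (syms l) z.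
Proof.
case=> t; elim: t z dh => [|t IH] z dh //; rewrite iterSr.
case E : (dig U z) => [[[s|h]|]|].
- rewrite (@dread d1 _ _ _ _ _ (dt dh) d1 MoveR (keep o30) (keep o31) (lpop (Some (inl s)) o32)) //; last by rewrite E.
  rewrite !lev_keep lev_pop => /IH [l I]; by exists (s :: l).
- rewrite (@dread d1 _ _ _ _ _ (dt dh) d5 MoveS (keep o30) (keep o31) (keep o32)) //; last by rewrite E.
  by move=> h'; case: (@d5_loop _ _ _ (ex_intro _ t h')).
- move=> _; exists [::] => /=; have /dig_Some := E.
  by rewrite /ix /= Rminus_0_r.
rewrite (@dread d1 _ _ _ _ _ (dt dh) d5 MoveS (keep o30) (keep o31) (keep o32)) //; last by rewrite E.
by move=> h'; case: (@d5_loop _ _ _ (ex_intro _ t h')).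
Qed.

Lemma d4_halts x y z dt dh : dhalts (d4, tri x y z, dt, dh) -> exists r, inI (syms r) y.
Proof.
case=> t; elim: t y dt dh => [|t IH] y dt dh //; rewrite iterSr.
case E : (dig U y) => [[[s|h]|]|].
- rewrite (@dwrite d4 _ _ _ _ _ (dt dh) d4 (letter_of (inl s)) MoveR (keep o30) (lpop (Some (inl s)) o31) (keep o32)) //; last by rewrite E.
  rewrite !lev_keep lev_pop => /IH [l I]; by exists (s :: l).
- rewrite (@dread d4 _ _ _ _ _ (dt dh) d5 MoveS (keep o30) (keep o31) (keep o32)) //; last by rewrite E.
  by move=> h'; case: (@d5_loop _ _ _ (ex_intro _ t h')).
- move=> _; exists [::] => /=; have /dig_Some := E.
  by rewrite /ix /= Rminus_0_r.
rewrite (@dread d4 _ _ _ _ _ (dt dh) d5 MoveS (keep o30) (keep o31) (keep o32)) //; last by rewrite E.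
by move=> h'; case: (@d5_loop _ _ _ (ex_intro _ t h')).
Qed.

(** Divergence off the regions, by contraposition: a halting run has read tape letters down to the
    end of a stack in [p.1], and a head cell followed by tape letters in [p.2], which make up a
    configuration. No bound on the stack heights is known beforehand, so the two popping loops are
    treated by induction on the halting time. *)
Lemma dhalts_region (p : point) : dhalts (d0, tri p.1 p.2 0, (fun=> None), 0%Z) ->
  exists w : seq T, region w p.
Proof.
move=> H; have H1 := dhalts_step (c := (d0, tri p.1 p.2 0, (fun=> None), 0%Z)) erefl H.
rewrite (@dread d0 _ _ _ _ _ None d1 MoveS (keep o30) (keep o31) (keep o30)) // !lev_keep in H1.
have [l hx] := d1_halts H1; have [x' [z' E]] := d_left hx.
have := dhalts_iter (3 * size l + 3) H; rewrite E => {}H.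
have R : wtape (map letter_of (rev (syms l))) (Z.of_nat (size l)) = None.
  by have := read_end (rev (syms l)); rewrite size_rev size_map.
have := dhalts_step (c := (d3, _, _, _)) erefl H.
have L k : dig U p.2 = k -> (if k is Some (Some (inr _)) then false else true) ->
    ~ dhalts (dstep (d3, tri x' p.2 z', wtape (map letter_of (rev (syms l))), Z.of_nat (size l))).
  move=> Ek nk; rewrite (@dread d3 _ _ _ _ _ None d5 MoveS (keep o30) (keep o31) (keep o32)) //.
    exact: d5_loop.
  by rewrite Ek; case: k nk {Ek} => [[[s|h]|]|].
case Ey : (dig U p.2) => [[[s|h]|]|]; try by move/(L _ Ey isT).
rewrite (@dwrite d3 _ _ _ _ _ None d4 (letter_of (inr h)) MoveR (keep o30) (lpop (Some (inr h)) o31) (keep o32)) //; last by rewrite Ey.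
rewrite !lev_keep lev_pop => /d4_halts [r hy].
case: h Ey hy => q a Ey hy.
by exists (tword (l, q, a :: r)); apply/region_tword.
Qed.

Lemma abs_init_point p : abs (init_point DM p) = (d0, tri p.1 p.2 0, (fun=> None), 0%Z).
Proof.
rewrite /abs /init_point; congr (_, _, _, _).
by apply: functional_extensionality; apply: ord3.
Qed.

Lemma DM_diverges p : dec U p = None -> diverges (init_point DM p).
Proof.
move=> /dec_None nr t; apply/negP => h; apply: nr; apply: dhalts_region; exists t.
by rewrite -abs_init_point -(abs_run t (init_point DM p)).1 -hc_state_abs.
Qed.

Lemma DM_halts p w : dec U p = Some w -> exists t,
  [/\ halts_at (init_point DM p) t, t <= 3 * size w + 6,
      hc_dtape (hb_run t (init_point DM p)) = wtape (map letter_of w) &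
      hc_rtape (hb_run t (init_point DM p)) 0%Z = 1%R].
Proof.
move=> /dec_Some R; have [t0 le0 [y [z [dh E]]]] := DM_run R.
have [A Rh] := abs_run t0 (init_point DM p); rewrite abs_init_point E in A.
have h0 : hb_halt DM (hc_state (hb_run t0 (init_point DM p))) by rewrite hc_state_abs A.
have [t [ht le Et]] := halts_at_le h0; exists t; split=> //.
- exact: leq_trans le le0.
- by rewrite Et hc_dtape_abs A.
have H0 := hc_rtape_abs o30 Rh; rewrite A in H0; rewrite Et; exact: H0.
Qed.

Lemma DM_computes : computes_D DM (@dec U).
Proof.
move=> p _; split=> [|w /DM_halts [t [ht _ Ed _]]]; first exact: DM_diverges.
exists t; split=> //; rewrite Ed; split.
  rewrite -[in RHS](mkseq_nth None (map letter_of w)) size_map.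
  by apply: eq_map => i; rewrite wtape_nat.
by move=> c; rewrite wtape_nat nth_default // size_map.
Qed.

Lemma DM_time : time_D DM (@dec U) (fun n => 3 * n + 6).
Proof.
move=> p w _ /DM_halts [t [ht le _ _]] t' ht'.
by rewrite (halts_at_uniq ht' ht).
Qed.

Definition slowdown (p : point) : option nat := omap (fun=> 1) (dec U p).

Lemma DM_computes_slowdown : computes_tau DM slowdown.
Proof.
move=> p _; rewrite /slowdown; case E : (dec U p) => [w|] /=; split=> //.
  by move=> n [<-]; have [t [ht _ _ Er]] := DM_halts E; exists t; rewrite Er.
by move=> _; exact: DM_diverges.
Qed.

End Decoder.

(** * Lower bounds *)

Section LowerBounds.
Variable U : TM.
Notation T := (cell U).

Section Machine.
Variables (A : Type) (M : HBSS A).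

(** Two runs that differ only in the discrete cell [m] stay alike until the discrete head has come
    there, whatever is computed on the reals. *)
Definition agree_off (m : Z) (c c' : hconf M) :=
  [/\ c.1.1 .1 = c'.1.1.1, c.1.1.2 = c'.1.1.2, c.2 = c'.2 &
      forall z, z <> m -> c.1.2 z = c'.1.2 z].

Lemma agree_off_step m c c' : agree_off m c c' -> c.2 <> m ->
  agree_off m (hb_step c) (hb_step c') /\ ((hb_step c).2 <= c.2 + 1)%Z.
Proof.
case: c => [[[[q rt] rh] dt] dh]; case: c' => [[[[q' rt'] rh'] dt'] dh'].
case=> /= -[<- <-] <- <- E ne; case: (hb_halt M q); first by split=> //=; lia.
rewrite -(E _ ne); case: (hb_delta _ _ _ _) => [[[[q1 a1] mr] md] y].
split; last by case: md => /=; lia.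
by split=> //= z nz; case: ifP => // _; exact: E.
Qed.

Lemma agree_off_run m c c' t : agree_off (Z.of_nat m) c c' -> c.2 = 0%Z -> t <= m ->
  agree_off (Z.of_nat m) (hb_run t c) (hb_run t c') /\ ((hb_run t c).2 <= Z.of_nat t)%Z.
Proof.
move=> H d0; elim: t => [|t IH] le; first by rewrite /= d0; split=> //; lia.
have [H1 D1] := IH (ltnW le).
have ne : (hb_run t c).2 <> Z.of_nat m by lia.
by have [H2 D2] := agree_off_step H1 ne; split=> //; rewrite /= in D2 *; lia.
Qed.

Lemma fresh_run (c : hconf M) (b : A) t :
  (forall z, c.1.2 z = b) -> c.2 = 0%Z ->
  ((hb_run t c).2 <= Z.of_nat t)%Z /\
  forall z, (Z.of_nat t <= z)%Z -> (hb_run t c).1.2 z = b.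
Proof.
move=> E d0; elim: t => [|t [IH1 IH2]]; first by rewrite /= d0; split=> //; lia.
move: IH1 IH2; rewrite /= -/(hb_run t c).
case: (hb_run t c) => [[[[q rt] rh] dt] dh] /= IH1 IH2.
case: (hb_halt M q); first by split=> [|z lt] /=; [lia | apply: IH2; lia].
case: (hb_delta _ _ _ _) => [[[[q1 a1] mr] md] y] /=.
split; first by case: md => /=; lia.
move=> z lt; case: Z.eqb_spec => [|_]; first lia.
by apply: IH2; lia.
Qed.

End Machine.

Definition long_word n (a : tsym U) : seq T :=
  rcons (inr (tm_start U, ord0) :: nseq n (inl ord0)) (inl a).

Lemma long_word_wf n a : wf_config (long_word n a).
Proof.
rewrite /wf_config /long_word -cats1 /= count_cat /=.
by elim: n => //= n; rewrite !addn0.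
Qed.

Lemma size_long_word n a : size (long_word n a) = n.+2.
Proof. by rewrite size_rcons /= size_nseq. Qed.

Lemma enc_inj w w' : wf_config w -> wf_config w' -> enc w = enc w' -> w = w' :> seq T.
Proof. by move=> h h' E; apply: (@region_uniq U w w' (enc w)); [|rewrite E]; exact: region_enc. Qed.

(** Two words that differ only in their last letter are indistinguishable before the head reaches
    that letter, yet [enc] is injective. *)
Lemma enc_lower_linear : E_lower_linear (@enc U).
Proof.
(* Length 2 is the least with room for the head cell and a separate last letter. *)
move=> k M _ C; exists 1, 2 => -[|[|n]] // _.
exists (long_word n (inord 1)); rewrite long_word_wf size_long_word; do 2!split=> //.
move=> t ht; rewrite mul1n ltnNge; apply/negP => le.
pose w1 := long_word n (inord 1); pose w2 := long_word n (inord 2).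
have Ag : agree_off (Z.of_nat n.+1) (init_word M w1) (init_word M w2).
  split=> // z nz; have N : (0 <= z)%Z ->
    nth None [seq Some (@inl _ 'I_k c) | c <- w1] (Z.to_nat z) =
    nth None [seq Some (@inl _ 'I_k c) | c <- w2] (Z.to_nat z).
    move=> z0; rewrite /w1 /w2 /long_word !map_rcons !nth_rcons !size_map [size _]/= size_nseq.
    by case: ltngtP => // E; case: nz; lia.
  by rewrite /init_word /=; case: Z.leb_spec.
have R s : s <= n.+1 -> (hb_run s (init_word M w1)).1.1.1 = (hb_run s (init_word M w2)).1.1.1.
  by move=> les; have [[]] := agree_off_run Ag erefl les.
have ht2 : halts_at (init_word M w2) t.
  case: ht => [h m]; split; first by rewrite /hc_state -R.
  by move=> t' lt; rewrite /hc_state -R; [exact: m | exact: leq_trans (ltnW lt) le].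
have [t1 [h1 E1]] := C w1 (long_word_wf _ _).
have [t2 [h2 E2]] := C w2 (long_word_wf _ _).
have : w1 = w2.
  apply: enc_inj; rewrite ?long_word_wf // -E1 -E2.
  by rewrite (halts_at_uniq h1 ht) (halts_at_uniq h2 ht2) /hc_rtape R.
move/rcons_inj => [] /(congr1 val); by rewrite /= !inordK.
Qed.

(** The last cell of the output is blank at the start, so the discrete head has to reach it. *)
Lemma dec_lower_linear : D_lower_linear (@dec U).
Proof.
move=> k M _ C; exists 1, 2 => -[|[|n]] // _.
pose w := long_word n ord0.
have D : dec U (enc w) = Some w by apply/dec_Some/region_enc/long_word_wf.
have dE : in_disk (enc w) by move/dec_Some: D; exact: region_disk.
exists (enc w), w; do 2!split=> //; split; first by rewrite size_long_word.
move=> t ht; rewrite mul1n ltnNge; apply/negP => le.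
have [_ /(_ _ D) [t' [ht' [O _]]]] := C _ dE.
rewrite (halts_at_uniq ht' ht) in O.
have [_ F] := @fresh_run _ M (init_point M (enc w)) None t (fun=> erefl) erefl.
have := congr1 (fun s => nth None s n.+1) O.
rewrite (nth_map 0) ?size_iota ?size_long_word // nth_iota ?size_long_word // add0n.
rewrite (nth_map (inl ord0)) ?size_long_word // -/(hc_dtape _) /hc_dtape F //.
by apply: inj_le; apply/leP.
Qed.

End LowerBounds.

(** * The complete system *)

Lemma computable_id : computable_nat id.
Proof.
exists {| tm_nsym := 0; tm_nst := 0; tm_start := ord0; tm_halt := xpredT;
          tm_delta := fun q a => (q, a, MoveS) |} => n.
exists 0; rewrite /iter tm_init_tword tm_halted_tword; split=> //.
rewrite tm_output_tword -[X in _ = X]take_size; congr take.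
elim: n => //= n ->; case: eqP => // /(congr1 val).
by rewrite /= inordK.
Qed.

Lemma enc_dec_CDS U : is_CDS (@disk_map U) (@enc U) (@dec U) (@slowdown U) (fun n => n).
Proof.
split; first by move=> p _; exact: disk_map_disk.
split; first by move=> w /region_enc; exact: region_disk.
split; first by move=> x w _ /dec_Some [].
split.
  exists 0, (EM U); split; first exact: EM_BSSC.
  have [C Tm] := EM_computes U; split=> //; exists 3 => w wf t h.
  by apply: leq_trans (Tm w wf t h) _; lia.
split.
  exists 0, (DM U); split; first exact: DM_BSSC.
  split; first exact: DM_computes.
  exists 6 => x w xd D t h; apply: leq_trans (DM_time xd D h) _; lia.
split; first by move=> x _; rewrite /slowdown; case: (dec U x).
split.
  move=> w K _ KC p q Kp Kq; rewrite /slowdown.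
  by have [_ ->] := KC p Kp; have [_ ->] := KC q Kq.
split.
  exists id; split; first exact: computable_id.
  exists 0, (DM U); split; first exact: DM_BSSC.
  split; first exact: DM_computes_slowdown.
  exists 6 => x w xd D t h; apply: leq_trans (DM_time xd D h) _; lia.
split; first by move=> w wf; apply/dec_Some/region_enc.
move=> w x _ [_ D]; exists 1; split; first by rewrite /slowdown D.
by apply/dec_Some/region_step/dec_Some.
Qed.

Theorem theorem4p4 :
  exists (U : TM) (f : point -> point) (E : seq (cell U) -> point)
         (D : point -> option (seq (cell U))) (tau : point -> option nat),
    universal_TM U /\
    smooth_disk_map f /\
    is_CDS f E D tau (fun n => n) /\
    robust_CDS E D /\
    (forall x, in_disk x -> D x <> None -> tau x = Some 1) /\
    E_lower_linear E /\
    D_lower_linear D.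
Proof.
exists UTM, (@disk_map UTM), (@enc UTM), (@dec UTM), (@slowdown UTM).
split; first exact: UTM_universal.
split; first exact: smooth_disk_map_disk_map.
split; first exact: enc_dec_CDS.
split; first exact: robust_enc_dec.
split; first by move=> x _; rewrite /slowdown; case: (dec UTM x).
split; [exact: enc_lower_linear | exact: dec_lower_linear].
Qed.
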